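(* Suppose $1\le r\le d_1/2$ and $N_{ij}\overset{\text{i.i.d.}}{\sim}\mathcal N(0,\sigma^2)$, and each $(i,j)$ lies in $\Omega$ independently with probability $p$. For $\sigma_r^\star>0$ let $\mathcal M^\star:=\{B\in\mathbb R^{d_1\times d_2}:\ \mathrm{rank}(B)=r,\ \sigma_r(B)\in[0.9\sigma_r^\star,1.1\sigma_r^\star]\}$ and let $U(B)\in\mathbb R^{d_1\times r}$ denote a matrix of the $r$ left singular vectors of $B$. Then there is a universal constant $c_{\mathsf{lb}}>0$ such that $$\inf_{\widehat U}\sup_{A^\star\in\mathcal M^\star}\mathbb E\Big[\min_{R\in\mathcal O^{r\times r}}\|\widehat UR-U(A^\star)\|\Big]\ge c_{\mathsf{lb}}\min\Big\{\frac{\sigma^2}{\sigma_r^{\star2}}\frac{\sqrt{d_1d_2}}{p}+\frac{\sigma}{\sigma_r^\star}\sqrt{\frac{d_1}{p}},\,1\Big\},$$ $$\inf_{\widehat U}\sup_{A^\star\in\mathcal M^\star}\mathbb E\Big[\min_{R\in\mathcal O^{r\times r}}\|\widehat UR-U(A^\star)\|_{2,\infty}\Big]\ge \frac{c_{\mathsf{lb}}}{\sqrt{d_1}}\min\Big\{\frac{\sigma^2}{\sigma_r^{\star2}}\frac{\sqrt{d_1d_2}}{p}+\frac{\sigma}{\sigma_r^\star}\sqrt{\frac{d_1}{p}},\,1\Big\},$$ where the infimum is over all estimators of $U(A^\star)$ based on $\mathcal P_\Omega(A^\star+N)$ (and $\Omega$).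
   Context: $\mathcal P_\Omega(M)$ keeps the entries of $M$ indexed by $\Omega$ and zeros out the rest. $\mathcal O^{r\times r}$ is the set of $r\times r$ orthogonal matrices; $\|\cdot\|$ is the spectral norm; $\|M\|_{2,\infty}$ is the largest row $\ell_2$ norm. *)

(* Defs.v *)
From HB Require Import structures.
From mathcomp Require Import all_boot all_order all_algebra.
From mathcomp Require Import all_classical all_reals all_analysis.
Set Implicit Arguments. Unset Strict Implicit. Unset Printing Implicit Defensive.
Import Order.TTheory GRing.Theory Num.Theory.
Local Open Scope classical_set_scope.
Local Open Scope ring_scope.

Section Defs.
Variable R : realType.

Definition vnorm2 n (v : 'cV[R]_n) : R := Num.sqrt (\sum_i v i 0 ^+ 2).

Definition spec_norm m n (M : 'M[R]_(m, n)) : R :=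
  sup [set vnorm2 (M *m x) | x in [set x : 'cV[R]_n | vnorm2 x = 1]].

Definition two_inf_norm m n (M : 'M[R]_(m, n)) : R :=
  \big[Num.max/0]_(i < m) Num.sqrt (\sum_(j < n) M i j ^+ 2).

Definition orthogonal_mx r (Q : 'M[R]_r) : Prop := Q^T *m Q = 1%:M.

Definition rot_loss d r (nrm : 'M[R]_(d, r) -> R) (Uh U : 'M[R]_(d, r)) : R :=
  inf [set nrm (Uh *m Q - U) | Q in [set Q : 'M[R]_r | orthogonal_mx Q]].

Definition compact_svd d1 d2 r (B : 'M[R]_(d1, d2)) (U : 'M[R]_(d1, r))
    (s : 'rV[R]_r) (V : 'M[R]_(d2, r)) : Prop :=
  [/\ U^T *m U = 1%:M, V^T *m V = 1%:M,
      (forall i, 0 < s 0 i),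
      (forall i j : 'I_r, (i <= j)%N -> s 0 j <= s 0 i) &
      B = U *m diag_mx s *m V^T].

(** The class M^star together with a choice of left singular vectors U(B):
    rank B = r and sigma_r(B) (the smallest, i.e. r-th, singular value)
    lies in [0.9 sstar, 1.1 sstar]. *)
Definition Mstar_U d1 d2 r (sstar : R) (B : 'M[R]_(d1, d2)) (U : 'M[R]_(d1, r)) : Prop :=
  \rank B = r /\
  exists (s : 'rV[R]_r) (V : 'M[R]_(d2, r)), compact_svd B U s V /\
    exists k : 'I_r, (forall i, s 0 k <= s 0 i) /\
      (9 / 10) * sstar <= s 0 k <= (11 / 10) * sstar.

Definition P_Omega d1 d2 (Om : {ffun 'I_d1 * 'I_d2 -> bool}) (M : 'M[R]_(d1, d2)) :=
  \matrix_(i, j) (if Om (i, j) then M i j else 0).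

Definition bern_weight d1 d2 (p : R) (Om : {ffun 'I_d1 * 'I_d2 -> bool}) : R :=
  \prod_(k : 'I_d1 * 'I_d2) (if Om k then p else 1 - p).

Definition tuple_mx d1 d2 (t : (d1 * d2).-tuple R) : 'M[R]_(d1, d2) :=
  \matrix_(i, j) tnth t (mxvec_index i j).

Fixpoint gauss_expect (sigma : R) (n : nat) : (n.-tuple R -> \bar R) -> \bar R :=
  match n return (n.-tuple R -> \bar R) -> \bar R with
  | 0 => fun F => F [tuple]
  | n'.+1 => fun F =>
      (\int[normal_prob 0 sigma]_x gauss_expect sigma (fun t => F (cons_tuple x t)))%E
  end.

(** Estimators: functions of (Omega, P_Omega(A + N)); required Borel measurable
    in the observed matrix. *)
Definition estimator_measurable d1 d2 r
    (Uhat : {ffun 'I_d1 * 'I_d2 -> bool} -> 'M[R]_(d1, d2) -> 'M[R]_(d1, r)) : Prop :=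
  forall Om a b, measurable_fun [set: (d1 * d2).-tuple R]
                   (fun t => Uhat Om (tuple_mx t) a b).

Definition risk d1 d2 r (sigma p : R) (nrm : 'M[R]_(d1, r) -> R)
    (Uhat : {ffun 'I_d1 * 'I_d2 -> bool} -> 'M[R]_(d1, d2) -> 'M[R]_(d1, r))
    (A : 'M[R]_(d1, d2)) (U : 'M[R]_(d1, r)) : \bar R :=
  (\sum_(Om : {ffun 'I_d1 * 'I_d2 -> bool})
     (bern_weight p Om)%:E *
     gauss_expect sigma (fun t : (d1 * d2).-tuple R =>
        (rot_loss nrm (Uhat Om (P_Omega Om (A + tuple_mx t))) U)%:E))%E.

Definition worst_risk d1 d2 r (sigma p sstar : R) (nrm : 'M[R]_(d1, r) -> R)
    (Uhat : {ffun 'I_d1 * 'I_d2 -> bool} -> 'M[R]_(d1, d2) -> 'M[R]_(d1, r)) : \bar R :=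
  ereal_sup [set e | exists (A : 'M[R]_(d1, d2)) (U : 'M[R]_(d1, r)),
                 Mstar_U sstar A U /\ e = risk sigma p nrm Uhat A U].

End Defs.

(* Main.v *)
(** Given an estimator, Assouad's lemma over a hypercube of hypotheses bounds its
    worst risk from below.  The top [r - 1] singular directions are fixed and the
    last left singular vector is [a e_0 + (q / sqrt m) sum_k eps_k e_k] with
    [a^2 + q^2 = 1], [m = d1 - r] and unknown signs [eps].  The sign of
    [(Uh Uh^T)_{k0}] is a rotation-invariant decoder for [eps_k], and the loss is
    at least [q / 3] times the fraction of wrongly decoded signs, both for the
    spectral norm and for [sqrt d1] times the two-to-infinity norm.

    It remains to make one sign hard to test with [q] of the order of the rate.
    If [p <= 1/2], a right singular vector supported on one column makes the only
    informative entry invisible with probability at least [1/2].  If [p > 1/2]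
    one may give away the full matrix [A + N].  The term
    [(sigma / sstar) sqrt d1] then comes from testing two Gaussians at distance
    [2 q sstar / sqrt m].  The quadratic term comes from a right singular vector
    [(eta_j / sqrt d2)_j] with uniformly random signs: the columns are then
    independent symmetric two-point mixtures, and the chi-square divergence
    between the two hypotheses is of order [q^2 sstar^4 / (sigma^4 d1 d2)].
    All Gaussian integrals are reduced to exponentials of linear forms. *)
Require Import Defs.
From HB Require Import structures.
From mathcomp Require Import all_boot all_order all_algebra.
From mathcomp Require Import all_classical all_reals all_analysis.
From mathcomp Require Import measurable_realfun normal_distribution zify ring lra.
Set Implicit Arguments. Unset Strict Implicit. Unset Printing Implicit Defensive.
Import Order.TTheory GRing.Theory Num.Theory.
Local Open Scope classical_set_scope.
Local Open Scope ring_scope.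

(** * Gaussian integrals *)

Section IntegralAux.
Local Open Scope ereal_scope.
Context d (T : measurableType d) (R : realType).
Variable mu : {measure set T -> \bar R}.

(* [ge0_le_integral] asks for measurability, which the loss, an infimum over
   uncountably many rotations, does not obviously have. *)
Lemma ge0_le_integral_nonmeasurable (f g : T -> \bar R) :
  (forall x, 0 <= f x) -> (forall x, f x <= g x) ->
  \int[mu]_x f x <= \int[mu]_x g x.
Proof.
move=> f0 fg; have g0 x : 0 <= g x by exact: le_trans (fg x).
rewrite !ge0_integralTE//; apply: le_ereal_sup => _ [h hf <-].
by exists h => // x; exact: le_trans (hf x) (fg x).
Qed.

End IntegralAux.

Lemma measurable_EFin_nat_of_bool d (T : measurableType d) (R : realType)
    (f : T -> bool) : measurable_fun setT f ->
  measurable_fun setT (fun t => ((f t)%:R : R)%:E).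
Proof.
move=> mf; apply/measurable_EFinP.
rewrite (_ : (fun t => _) = (fun t => if f t then 1 else 0 : R)%R); last first.
  by apply/funext => t; case: (f t).
exact: measurable_fun_ifT.
Qed.

(** * Translation of Lebesgue and normal measures *)

Section LebesgueTranslation.
Local Open Scope ereal_scope.
Context (R : realType).
Notation mu := (@lebesgue_measure R).

Lemma measurable_shiftr (a : R) : measurable_fun [set: R] (fun x : R => (x + a)%R).
Proof. by exact: measurable_funD. Qed.

(** By uniqueness of Lebesgue measure it is enough to look at half-open intervals, whose preimages
    under the shift have the same length. *)
Lemma lebesgue_measure_shift (a : R) A : measurable A ->
  mu A = pushforward mu (fun x : R => (x + a)%R) A.
Proof.
move=> mA.
pose phi := (fun x : R => (x + a)%R) : measurableTypeR R -> measurableTypeR R.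
have mphi : measurable_fun setT phi by exact: measurable_shiftr.
pose phim := isMeasurableFun.Build _ _ _ _ _ mphi.
pose phip : {mfun _ >-> _} := HB.pack phi phim.
rewrite (@lebesgue_measure_unique R (pushforward mu phip))//.
move=> _ [[b c] _ <-] /=; rewrite /pushforward.
have -> : phip @^-1` `]b, c] = `](b - a)%R, (c - a)%R]%classic.
  apply/seteqP; split => x /=; rewrite !in_itv/= /phi ltrBlDr lerBrDr//.
rewrite !lebesgue_measure_itv/= !lte_fin ltrD2r; case: ifP => // _.
by rewrite -!EFinB; congr _%:E; ring.
Qed.

Lemma ge0_integral_shift (a : R) (f : R -> \bar R) :
  measurable_fun setT f -> (forall x, 0 <= f x) ->
  \int[mu]_x f (x + a)%R = \int[mu]_x f x.
Proof.
move=> mf f0.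
pose phi := (fun x : R => (x + a)%R) : measurableTypeR R -> measurableTypeR R.
have mphi : measurable_fun setT phi by exact: measurable_shiftr.
transitivity (\int[pushforward mu phi]_x f x); last first.
  apply: eq_measure_integral => A mA _.
  by first [exact: lebesgue_measure_shift | exact/esym/lebesgue_measure_shift].
by rewrite ge0_integral_pushforward.
Qed.

End LebesgueTranslation.

Section NormalDensity.
Local Open Scope ereal_scope.
Context (R : realType).
Notation mu := (@lebesgue_measure R).
Variables (m s : R).

(** The Radon-Nikodym derivative of [normal_prob] and the explicit density have the same integral
    over every measurable set, hence agree almost everywhere. *)
Lemma ge0_integral_normal_prob (f : R -> \bar R) :
  measurable_fun setT f -> (forall x, 0 <= f x) ->
  \int[normal_prob m s]_x f x = \int[mu]_x (f x * (normal_pdf m s x)%:E).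
Proof.
move=> mf f0.
pose nu : {finite_measure set _ -> \bar R} := normal_prob m s.
have dom : nu `<< mu by exact: normal_prob_dominates.
rewrite -(Radon_Nikodym_SigmaFinite.change_of_variables dom)//=.
apply: ae_eq_integral => //.
- apply: emeasurable_funM => //; apply: (measurable_int mu).
  exact: Radon_Nikodym_SigmaFinite.f_integrable.
- apply: emeasurable_funM => //; apply/measurable_EFinP.
  exact: measurable_normal_pdf.
- apply: ae_eqe_mul2l.
  apply: integral_ae_eq => //=.
  + exact: Radon_Nikodym_SigmaFinite.f_integrable.
  + by apply/measurable_EFinP; exact: measurable_normal_pdf.
  + by move=> E E01 mE; rewrite -Radon_Nikodym_SigmaFinite.f_integral.
Qed.

End NormalDensity.

Section NormalShift.
Local Open Scope ereal_scope.
Context (R : realType) (s : R) (s0 : s != 0%R).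
Notation mu := (@lebesgue_measure R).

Lemma normal_pdf_shift (a x : R) :
  normal_pdf 0 s (x - a)%R =
  (normal_pdf 0 s x * expR ((a * x - a ^+ 2 / 2) / s ^+ 2))%R.
Proof.
rewrite !normal_pdfE// -mulrA; congr *%R; rewrite /normal_fun -expRD.
by congr expR; field.
Qed.

Lemma measurable_tilt (a : R) :
  measurable_fun [set: R] (fun x : R => (expR ((a * x - a ^+ 2 / 2) / s ^+ 2))).
Proof.
apply: measurableT_comp => //; apply: measurable_funM => //.
by apply: measurable_funB => //; apply: measurable_funM.
Qed.

Lemma normal_prob_shift (a : R) (f : R -> \bar R) :
  measurable_fun setT f -> (forall x, 0 <= f x) ->
  \int[normal_prob 0 s]_x f (x + a)%R =
  \int[normal_prob 0 s]_x (f x * (expR ((a * x - a ^+ 2 / 2) / s ^+ 2))%:E).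
Proof.
move=> mf f0.
have mt := measurable_tilt a.
have mp := @measurable_normal_pdf R 0 s.
rewrite ge0_integral_normal_prob//; last first.
  by apply: (measurableT_comp mf); exact: measurable_shiftr.
rewrite ge0_integral_normal_prob//; last 2 first.
  by apply: emeasurable_funM => //; exact/measurable_EFinP.
  by move=> x; rewrite mule_ge0// lee_fin expR_ge0.
(* After this translation both integrands contain [f (x + a)], and the tilt turns the density at
   [x + a] into the density at [x]. *)
rewrite -[RHS](@ge0_integral_shift _ a)//; last 2 first.
  by apply: emeasurable_funM; [apply: emeasurable_funM => //|]; exact/measurable_EFinP.
  by move=> x; rewrite !mule_ge0 ?lee_fin ?expR_ge0 ?normal_pdf_ge0.
apply: eq_integral => x _; rewrite -muleA -EFinM [X in _ = _ * X%:E]mulrC.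
by rewrite -normal_pdf_shift addrK.
Qed.

End NormalShift.

Lemma tnth_cons_tuple0 (T : Type) n (x : T) (t : n.-tuple T) :
  tnth (cons_tuple x t) ord0 = x.
Proof. by []. Qed.

Lemma tnth_cons_tupleS (T : Type) n (x : T) (t : n.-tuple T) i :
  tnth (cons_tuple x t) (lift ord0 i) = tnth t i.
Proof. exact: tnthS. Qed.

(** * The iterated Gaussian expectation *)

Section GaussExpect.
Local Open Scope ereal_scope.
Context (R : realType) (s : R).
Local Notation E := (gauss_expect s).

Lemma gauss_expect_ge0 n (F : n.-tuple R -> \bar R) :
  (forall t, 0 <= F t) -> 0 <= E F.
Proof.
elim: n F => [|n IH] F F0 /=; first exact: F0.
by apply: integral_ge0 => x _; exact: IH.
Qed.

Lemma le_gauss_expect n (F G : n.-tuple R -> \bar R) :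
  (forall t, 0 <= F t) -> (forall t, F t <= G t) -> E F <= E G.
Proof.
elim: n F G => [|n IH] F G F0 FG /=; first exact: FG.
apply: ge0_le_integral_nonmeasurable => x.
  exact: gauss_expect_ge0.
by apply: IH.
Qed.

(** The parameter space [T] is arbitrary so that the induction can move the first coordinate into
    it; Tonelli then integrates that coordinate. *)
Lemma measurable_gauss_expect_param d (T : measurableType d) n
    (F : T * n.-tuple R -> \bar R) :
  measurable_fun setT F -> (forall z, 0 <= F z) ->
  measurable_fun setT (fun z => E (fun t => F (z, t))).
Proof.
elim: n d T F => [|n IH] d T F mF F0 /=.
  apply: (measurableT_comp mF); apply/measurable_fun_pairP.
  split => /=; last exact: measurable_cst. exact: measurable_id.
pose G (y : T * R) := E (fun t => F (y.1, cons_tuple y.2 t)).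
have mG : measurable_fun setT G.
  apply: (IH _ _ (fun y : (T * R) * n.-tuple R => F (y.1.1, cons_tuple y.1.2 y.2))) => //.
  apply: (measurableT_comp mF); apply/measurable_fun_pairP; split => /=.
    exact: (measurableT_comp measurable_fst measurable_fst).
  apply: measurable_cons => //.
  exact: (measurableT_comp measurable_snd measurable_fst).
apply: (@measurable_fun_fubini_tonelli_F _ _ _ _ _ (normal_prob 0 s) G) => //.
by move=> y; exact: gauss_expect_ge0.
Qed.

Lemma measurable_cons_tuple n :
  measurable_fun setT (fun z : R * n.-tuple R => cons_tuple z.1 z.2).
Proof. by apply: (@measurable_cons _ _ _ _ fst _ snd). Qed.

Lemma measurable_cons_tuple_cst n (x : R) :
  measurable_fun setT (fun t : n.-tuple R => cons_tuple x t).
Proof. by apply: (@measurable_cons _ _ _ _ (cst x) _ id). Qed.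

Lemma measurable_gauss_expect_cons n (F : n.+1.-tuple R -> \bar R) :
  measurable_fun setT F -> (forall z, 0 <= F z) ->
  measurable_fun setT (fun x : R => E (fun t => F (cons_tuple x t))).
Proof.
move=> mF F0.
apply: (@measurable_gauss_expect_param _ _ n (fun z => F (cons_tuple z.1 z.2))) => //.
by apply: (measurableT_comp mF); exact: measurable_cons_tuple.
Qed.

Lemma ge0_gauss_expectD n (F G : n.-tuple R -> \bar R) :
  measurable_fun setT F -> (forall z, 0 <= F z) ->
  measurable_fun setT G -> (forall z, 0 <= G z) ->
  E (fun t => F t + G t) = E F + E G.
Proof.
elim: n F G => [|n IH] F G mF F0 mG G0 //=.
rewrite -ge0_integralD//; first last.
- exact: measurable_gauss_expect_cons.
- by move=> x _; exact: gauss_expect_ge0.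
- exact: measurable_gauss_expect_cons.
- by move=> x _; exact: gauss_expect_ge0.
apply: eq_integral => x _; apply: IH => //.
- by apply: (measurableT_comp mF); exact: measurable_cons_tuple_cst.
- by apply: (measurableT_comp mG); exact: measurable_cons_tuple_cst.
Qed.

Lemma ge0_gauss_expectZl n (c : R) (F : n.-tuple R -> \bar R) : (0 <= c)%R ->
  measurable_fun setT F -> (forall z, 0 <= F z) ->
  E (fun t => c%:E * F t) = c%:E * E F.
Proof.
move=> c0; elim: n F => [|n IH] F mF F0 //=.
rewrite -ge0_integralZl_EFin//; last 2 first.
- by move=> x _; exact: gauss_expect_ge0.
- exact: measurable_gauss_expect_cons.
apply: eq_integral => x _; apply: IH => //.
by apply: (measurableT_comp mF); exact: measurable_cons_tuple_cst.
Qed.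

Lemma eq_gauss_expect n (F G : n.-tuple R -> \bar R) : F =1 G -> E F = E G.
Proof. by move=> /funext ->. Qed.

Lemma gauss_expect_cst n (c : R) : E (fun _ : n.-tuple R => c%:E) = c%:E.
Proof.
elim: n => //= n ->; rewrite integral_cst//.
by rewrite [X in _ * X]probability_setT mule1.
Qed.

Lemma ge0_gauss_expect_sum n (I : Type) (r : seq I) (F : I -> n.-tuple R -> \bar R) :
  (forall i, measurable_fun setT (F i)) -> (forall i z, 0 <= F i z) ->
  E (fun t => \sum_(i <- r) F i t) = \sum_(i <- r) E (F i).
Proof.
move=> mF F0; elim: r => [|i r IH].
  by under eq_gauss_expect do rewrite big_nil; rewrite big_nil gauss_expect_cst.
under eq_gauss_expect do rewrite big_cons.
rewrite ge0_gauss_expectD//; first by rewrite IH big_cons.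
  by apply: emeasurable_sum.
by move=> z; apply: sume_ge0 => j _.
Qed.

Definition tshift n (a : 'I_n -> R) (t : n.-tuple R) : n.-tuple R :=
  [tuple (tnth t i + a i)%R | i < n].

Lemma tnth_tshift n (a : 'I_n -> R) t i : tnth (tshift a t) i = (tnth t i + a i)%R.
Proof. by rewrite tnth_mktuple. Qed.

Lemma tshift_cons n (a : 'I_n.+1 -> R) (x : R) (t : n.-tuple R) :
  tshift a (cons_tuple x t) =
  cons_tuple (x + a ord0)%R (tshift (fun i => a (lift ord0 i)) t).
Proof.
apply: eq_from_tnth => i; rewrite tnth_tshift.
case: (unliftP ord0 i) => [j|] ->; last by rewrite !tnth_cons_tuple0.
by rewrite !tnth_cons_tupleS tnth_tshift.
Qed.

Lemma measurable_tshift n (a : 'I_n -> R) : measurable_fun setT (tshift a).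
Proof.
apply/measurable_fun_tnthP => i.
rewrite (_ : _ \o _ = (fun t : n.-tuple R => tnth t i + a i)%R); last first.
  by apply/funext => t /=; rewrite tnth_tshift.
by apply: measurable_funD => //; exact: measurable_tnth.
Qed.

(* The density of [N(a, s^2 I)] with respect to [N(0, s^2 I)]. *)
Definition tilt n (a : 'I_n -> R) (t : n.-tuple R) : R :=
  expR (\sum_i (a i * tnth t i - a i ^+ 2 / 2) / s ^+ 2)%R.

Lemma tilt_ge0 n (a : 'I_n -> R) t : (0 <= tilt a t)%R.
Proof. exact: expR_ge0. Qed.

Lemma measurable_tilt_tuple n (a : 'I_n -> R) : measurable_fun setT (tilt a).
Proof.
apply: measurableT_comp => //; apply: measurable_sum => i.
apply: measurable_funM => //; apply: measurable_funB => //.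
by apply: measurable_funM => //; exact: measurable_tnth.
Qed.

(** Change of measure, one coordinate at a time: [normal_prob_shift] treats the first one, induction
    the others, and the tilt is a product over coordinates. *)
Lemma gauss_expect_shift n (a : 'I_n -> R) (F : n.-tuple R -> \bar R) : s != 0%R ->
  measurable_fun setT F -> (forall z, 0 <= F z) ->
  E (fun t => F (tshift a t)) = E (fun t => F t * (tilt a t)%:E).
Proof.
move=> s0; elim: n a F => [|n IH] a F mF F0 /=.
  rewrite /tilt big_ord0 expR0 mule1; congr F.
  by apply: eq_from_tnth; case.
pose a' i := a (lift ord0 i).
pose g y := E (fun t => F (cons_tuple y t) * (tilt a' t)%:E).
have mtl : measurable_fun setT (fun z : R * n.-tuple R => (tilt a' z.2)%:E).
  by apply/measurable_EFinP; apply: (measurableT_comp (measurable_tilt_tuple a')).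
transitivity (\int[normal_prob 0 s]_x g (x + a ord0)%R).
  apply: eq_integral => x _.
  under eq_gauss_expect do rewrite tshift_cons.
  rewrite (IH a' (fun t => F (cons_tuple (x + a ord0)%R t)))//.
  by apply: (measurableT_comp mF); exact: measurable_cons_tuple_cst.
rewrite normal_prob_shift//; last 2 first.
- apply: (@measurable_gauss_expect_param _ _ n
    (fun z => F (cons_tuple z.1 z.2) * (tilt a' z.2)%:E)) => [|z].
    apply: emeasurable_funM => //.
    by apply: (measurableT_comp mF); exact: measurable_cons_tuple.
  by rewrite mule_ge0// lee_fin tilt_ge0.
- by move=> x; apply: gauss_expect_ge0 => t; rewrite mule_ge0// lee_fin tilt_ge0.
apply: eq_integral => x _.
rewrite muleC -ge0_gauss_expectZl ?expR_ge0//; last 2 first.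
- apply: emeasurable_funM => //.
    by apply: (measurableT_comp mF); exact: measurable_cons_tuple_cst.
  by apply/measurable_EFinP; exact: measurable_tilt_tuple.
- by move=> t; rewrite mule_ge0// lee_fin tilt_ge0.
apply: eq_gauss_expect => t; rewrite muleCA -EFinM -expRD.
congr (_ * (expR _)%:E); rewrite big_ord_recl tnth_cons_tuple0; congr +%R.
by apply: eq_bigr => i _; rewrite tnth_cons_tupleS.
Qed.

Lemma gauss_expect_tilt n (a : 'I_n -> R) : s != 0%R ->
  E (fun t => (tilt a t)%:E) = 1.
Proof.
move=> s0; have := @gauss_expect_shift n a (cst 1) s0.
rewrite /= gauss_expect_cst => ->//.
by apply: eq_gauss_expect => t; rewrite mul1e.
Qed.

(** Completing the square makes the integrand a constant times the tilt by [b i * s ^+ 2], which has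
    mean 1. *)
Lemma gauss_expect_expR n (b : 'I_n -> R) : s != 0%R ->
  E (fun t => (expR (\sum_i b i * tnth t i))%:E) =
  (expR (\sum_i (b i ^+ 2) * s ^+ 2 / 2))%:E.
Proof.
move=> s0.
have s20 : (s ^+ 2)%R != 0%R by rewrite expf_neq0.
transitivity (E (fun t => (expR (\sum_i (b i ^+ 2) * s ^+ 2 / 2))%:E *
    (tilt (fun i => b i * s ^+ 2)%R t)%:E)).
  apply: eq_gauss_expect => t; rewrite -EFinM -expRD -big_split/=.
  by congr (expR _)%:E; apply: eq_bigr => i _; field.
rewrite ge0_gauss_expectZl ?expR_ge0 ?gauss_expect_tilt ?mule1//.
- by apply/measurable_EFinP; exact: measurable_tilt_tuple.
- by move=> t; rewrite lee_fin tilt_ge0.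
Qed.

(* Signed combinations of exponentials are compared through their positive and
   negative parts. *)
Lemma gauss_expect_ge_expsum n (K : finType) (c : K -> R) (b : K -> 'I_n -> R)
    (F : n.-tuple R -> \bar R) : s != 0%R ->
  measurable_fun setT F -> (forall z, 0 <= F z) ->
  (forall t, (\sum_k c k * expR (\sum_i b k i * tnth t i))%:E <= F t) ->
  (\sum_k c k * expR (\sum_i (b k i ^+ 2) * s ^+ 2 / 2))%:E <= E F.
Proof.
move=> s0 mF F0 leF.
pose cp k := Num.max (c k) 0%R; pose cn k := Num.max (- c k)%R 0%R.
have cE k : c k = (cp k - cn k)%R.
  rewrite /cp /cn; have [h|/ltW h] := leP (c k) 0%R.
    by rewrite (@max_l _ _ (- c k)%R) ?oppr_ge0// sub0r opprK.
  by rewrite (@max_r _ _ (- c k)%R) ?oppr_le0// subr0.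
have cp0 k : (0 <= cp k)%R by rewrite le_max lexx orbT.
have cn0 k : (0 <= cn k)%R by rewrite le_max lexx orbT.
pose e k t : R := expR (\sum_i b k i * tnth t i).
pose v k := expR (\sum_i (b k i ^+ 2) * s ^+ 2 / 2).
have me k : measurable_fun setT (fun t : n.-tuple R => (e k t)%:E).
  apply/measurable_EFinP; apply: measurableT_comp => //; apply: measurable_sum => i.
  by apply: measurable_funM => //; exact: measurable_tnth.
have e0 k t : 0 <= (e k t)%:E by rewrite lee_fin expR_ge0.
have Ee (d : K -> R) : (forall k, 0 <= d k)%R ->
    E (fun t => \sum_k (d k)%:E * (e k t)%:E) = (\sum_k d k * v k)%:E.
  move=> d0; rewrite ge0_gauss_expect_sum; last 2 first.
  - by move=> k; apply: measurable_funeM; exact: me.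
  - by move=> k t; apply: mule_ge0; [rewrite lee_fin d0|exact: e0].
  rewrite -sumEFin; apply: eq_bigr => k _.
  by rewrite ge0_gauss_expectZl// gauss_expect_expR.
rewrite (_ : \sum_k _ = \sum_k cp k * v k - \sum_k cn k * v k)%R; last first.
  by rewrite -sumrB; apply: eq_bigr => k _; rewrite cE mulrBl.
rewrite EFinB leeBlDr// -!Ee// -ge0_gauss_expectD//; first last.
- by move=> z; apply: sume_ge0 => k _; apply: mule_ge0; [rewrite lee_fin|exact: e0].
- by apply: emeasurable_sum => k; apply: measurable_funeM; exact: me.
apply: le_gauss_expect => t; first by apply: sume_ge0 => k _; apply: mule_ge0; [rewrite lee_fin|exact: e0].
have sE (d : K -> R) : \sum_k (d k)%:E * (e k t)%:E = (\sum_k d k * e k t)%:E.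
  by rewrite -sumEFin; apply: eq_bigr.
rewrite !sE -leeBlDr//; apply: le_trans (leF t).
rewrite -EFinB lee_fin -sumrB le_eqVlt; apply/orP; left; apply/eqP.
by apply: eq_bigr => k _; rewrite cE mulrBl.
Qed.

End GaussExpect.


(** * Testing Gaussian shifts *)

Lemma sum_mxvec_index (R : nmodType) m n (f : 'I_(m * n) -> R) :
  \sum_l f l = \sum_i \sum_j f (mxvec_index i j).
Proof.
rewrite pair_bigA/= (reindex (uncurry (@mxvec_index m n))) /=.
  by apply: eq_bigr => -[i j].
exact: curry_mxvec_bij.
Qed.

Lemma expR_half_le2 (R : realType) (x : R) : x <= 1 / 2 -> expR x <= 2.
Proof.
move=> hx; have h : expR (- x) >= 1 / 2 by have := expR_ge1Dx (- x); lra.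
have := expRxMexpNx_1 x; have := expR_gt0 x; nra.
Qed.

Lemma prod1D_le2 (R : realType) (I : finType) (k : I -> R) :
  \sum_i k i <= 1 / 2 -> (forall i, 0 <= k i) -> \prod_i (1 + k i) <= 2.
Proof.
move=> hk k0; apply: le_trans (expR_half_le2 hk); rewrite expR_sum.
by apply: ler_prod => i _; rewrite expR_ge1Dx addr_ge0.
Qed.

(** * Combinations of exponentials with explicit Gaussian means *)

Section Expfam.
Context (R : realType) (s : R).

(* A family [f j] of finite signed combinations of exponentials of linear forms
   with its closed-form Gaussian means [v j].  The index set [K] is common to
   the whole family so that products over [j] can be expanded. *)
Definition expfam (J : Type) n (f : J -> ('I_n -> R) -> R) (v : J -> R) : Prop :=
  exists (K : finType) (c : J -> K -> R) (b : J -> K -> 'I_n -> R),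
    (forall j y, f j y = \sum_k c j k * expR (\sum_i b j k i * y i)) /\
    (forall j, v j = \sum_k c j k * expR (\sum_i b j k i ^+ 2 * s ^+ 2 / 2)).

(** The density [tilt] again, on functions instead of tuples, so that it can be evaluated on a
    single column of the observation. *)
Definition vtilt n (a y : 'I_n -> R) : R :=
  expR (\sum_i (a i * y i - a i ^+ 2 / 2) / s ^+ 2).

Context (s0 : s != 0).

Let s20 : s ^+ 2 != 0. Proof. by rewrite expf_neq0. Qed.

Lemma expfam_vtilt (J : Type) n (c : J -> R) (a : J -> 'I_n -> R) :
  expfam (fun j y => c j * vtilt (a j) y) c.
Proof.
exists unit.
exists (fun j _ => c j * expR (- (\sum_i a j i ^+ 2 / 2 / s ^+ 2))).
exists (fun j _ i => a j i / s ^+ 2); split => [j y|j]; rewrite big_const card_unit/= addr0.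
  rewrite -mulrA -expRD -sumrN -big_split/=; congr (_ * expR _).
  by apply: eq_bigr => i _; field.
rewrite -[RHS]mulrA -expRD -sumrN -big_split/= [X in _ = _ * expR X]big1 ?expR0 ?mulr1// => i _.
by field.
Qed.

(** As each [vtilt] has mean 1, the exponential factor is the mean of the product of two
    likelihoods. *)
Lemma vtiltM n (a b y : 'I_n -> R) :
  vtilt a y * vtilt b y =
  expR ((\sum_i a i * b i) / s ^+ 2) * vtilt (fun i => a i + b i) y.
Proof.
rewrite -!expRD; congr expR; rewrite mulr_suml -!big_split/=.
by apply: eq_bigr => i _; field.
Qed.

(** The exponential factor is one plus the chi-square divergence between the two shifted
    Gaussians. *)
Lemma vtilt_div n (a b y : 'I_n -> R) :
  vtilt a y ^+ 2 / vtilt b y =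
  expR ((\sum_i (a i - b i) ^+ 2) / s ^+ 2) * vtilt (fun i => 2 * a i - b i) y.
Proof.
rewrite expr2 -!expRN -!expRD; congr expR.
rewrite mulr_suml -sumrN -!big_split/=.
by apply: eq_bigr => i _; field.
Qed.

Lemma expfamD (J : Type) n (f g : J -> ('I_n -> R) -> R) v w :
  expfam f v -> expfam g w ->
  expfam (fun j y => f j y + g j y) (fun j => v j + w j).
Proof.
move=> [K [c [b [fE vE]]]] [L [d [e [gE wE]]]].
exists (K + L)%type.
exists (fun j k => match k with inl k => c j k | inr l => d j l end).
exists (fun j k => match k with inl k => b j k | inr l => e j l end).
by split => [j y|j]; rewrite big_sumType/= ?fE ?gE ?vE ?wE.
Qed.

Lemma expfamZ (J : Type) n (u : J -> R) (f : J -> ('I_n -> R) -> R) v :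
  expfam f v -> expfam (fun j y => u j * f j y) (fun j => u j * v j).
Proof.
move=> [K [c [b [fE vE]]]]; exists K, (fun j k => u j * c j k), b.
by split => [j y|j]; rewrite ?fE ?vE mulr_sumr; apply: eq_bigr => k _; rewrite mulrA.
Qed.

Lemma expfam_ext (J : Type) n (f g : J -> ('I_n -> R) -> R) v w :
  (forall j y, f j y = g j y) -> (forall j, v j = w j) -> expfam f v -> expfam g w.
Proof.
move=> fg vw [K [c [b [fE vE]]]]; exists K, c, b.
by split => [j y|j]; rewrite -?fg -?vw.
Qed.

Lemma expfam_sqr (J : Type) n (P : finType) (c : J -> P -> R)
    (a : J -> P -> 'I_n -> R) :
  expfam (fun j y => (\sum_p c j p * vtilt (a j p) y) ^+ 2)
    (fun j => \sum_p \sum_q c j p * c j q *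
                expR ((\sum_i a j p i * a j q i) / s ^+ 2)).
Proof.
exists (P * P)%type.
pose a2 j (k : P * P) i := a j k.1 i + a j k.2 i.
exists (fun j k => c j k.1 * c j k.2 * expR ((\sum_i a j k.1 i * a j k.2 i) / s ^+ 2) *
          expR (- (\sum_i a2 j k i ^+ 2 / 2 / s ^+ 2))).
exists (fun j k i => a2 j k i / s ^+ 2); split => [j y|j].
  rewrite expr2 mulr_suml.
  under eq_bigr do rewrite mulr_sumr.
  rewrite pair_bigA/=; apply: eq_bigr => -[p q] _ /=.
  rewrite mulrACA vtiltM -!mulrA; do 3 congr (_ * _).
  rewrite -expRD; congr expR; rewrite -sumrN -big_split/=.
  by apply: eq_bigr => i _; rewrite /a2/=; field.
rewrite pair_bigA/=; apply: eq_bigr => -[p q] _ /=.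
rewrite -[RHS]mulrA -expRD -sumrN -big_split/= [X in _ = _ * expR X]big1 ?expR0 ?mulr1// => i _.
by field.
Qed.

(** Expanding the product gives one term for each choice function from columns to [K]. Columns are
    disjoint blocks of coordinates, so the mean of each term factors. *)
Lemma expfam_prod m n (f : 'I_n -> ('I_m -> R) -> R) v :
  expfam f v ->
  expfam (fun (_ : unit) (y : 'I_(m * n) -> R) =>
            \prod_j f j (fun i => y (mxvec_index i j)))
         (fun _ => \prod_j v j).
Proof.
move=> [K [c [b [fE vE]]]].
pose row (l : 'I_(m * n)) := (enum_val (cast_ord (esym (mxvec_cast m n)) l)).1.
pose col (l : 'I_(m * n)) := (enum_val (cast_ord (esym (mxvec_cast m n)) l)).2.
have rowE i j : row (mxvec_index i j) = i by rewrite /row /mxvec_index cast_ordK enum_rankK.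
have colE i j : col (mxvec_index i j) = j by rewrite /col /mxvec_index cast_ordK enum_rankK.
exists {ffun 'I_n -> K}, (fun _ (k : {ffun 'I_n -> K}) => \prod_j c j (k j)).
exists (fun _ (k : {ffun 'I_n -> K}) l => b (col l) (k (col l)) (row l)); split=> [_ y|_].
  under eq_bigr do rewrite fE.
  rewrite bigA_distr_bigA; apply: eq_bigr => k _ /=.
  rewrite big_split/= -expR_sum sum_mxvec_index exchange_big/=.
  by do 2 f_equal; apply: eq_bigr => j _; apply: eq_bigr => i _; rewrite rowE colE.
under eq_bigr do rewrite vE.
rewrite bigA_distr_bigA; apply: eq_bigr => k _ /=.
rewrite big_split/= -expR_sum sum_mxvec_index exchange_big/=.
by do 2 f_equal; apply: eq_bigr => j _; apply: eq_bigr => i _; rewrite rowE colE.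
Qed.

Lemma gauss_expect_ge_expfam n (f : unit -> ('I_n -> R) -> R) v
    (F : n.-tuple R -> \bar R) : expfam f v ->
  measurable_fun setT F -> (forall z, 0 <= F z)%E ->
  (forall t, ((f tt (fun i => tnth t i))%:E <= F t)%E) ->
  ((v tt)%:E <= gauss_expect s F)%E.
Proof.
move=> [K [c [b [fE vE]]]] mF F0 fF; rewrite vE.
by apply: gauss_expect_ge_expsum => // t; rewrite -fE; exact: fF.
Qed.

(* The optimal sum of errors is the mean of the minimum of the two mixture
   likelihoods; [f] is a minorant of this minimum whose mean is explicit. *)
Lemma mixture_test n (H : finType) (a a' : H -> 'I_n -> R)
    (psi : n.-tuple R -> bool) (f : unit -> ('I_n -> R) -> R) v :
  measurable_fun setT psi -> expfam f v ->
  (forall y, f tt y <= \sum_h #|H|%:R^-1 * vtilt (a h) y) ->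
  (forall y, f tt y <= \sum_h #|H|%:R^-1 * vtilt (a' h) y) ->
  ((v tt)%:E <= \sum_h (#|H|%:R^-1)%:E *
     (gauss_expect s (fun t => (psi (tshift (a h) t))%:R%:E) +
      gauss_expect s (fun t => (~~ psi (tshift (a' h) t))%:R%:E)))%E.
Proof.
move=> mpsi ef fa fa'.
have mI (phi : n.-tuple R -> bool) := @measurable_EFin_nat_of_bool _ _ R phi.
have I0 (phi : n.-tuple R -> bool) t : (0 <= ((phi t)%:R : R)%:E)%E by rewrite lee_fin ler0n.
have mnpsi : measurable_fun setT (fun t => ~~ psi t).
  exact: measurable_neg.
have mt (b : 'I_n -> R) : measurable_fun setT (fun t => (tilt s b t)%:E).
  by apply/measurable_EFinP; exact: measurable_tilt_tuple.
have mIt (phi : n.-tuple R -> bool) (b : 'I_n -> R) : measurable_fun setT phi ->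
    measurable_fun setT (fun t => ((phi t)%:R : R)%:E * (tilt s b t)%:E)%E.
  by move=> mphi; apply: emeasurable_funM; [exact: mI|exact: mt].
have It0 (phi : n.-tuple R -> bool) (b : 'I_n -> R) t :
    (0 <= ((phi t)%:R : R)%:E * (tilt s b t)%:E)%E.
  by rewrite mule_ge0// lee_fin tilt_ge0.
have It20 h t : (0 <= (psi t)%:R%:E * (tilt s (a h) t)%:E +
    (~~ psi t)%:R%:E * (tilt s (a' h) t)%:E)%E.
  by apply: adde_ge0; [exact: It0|exact: (It0 (fun t => ~~ psi t))].
have mIt2 h : measurable_fun setT (fun t => (psi t)%:R%:E * (tilt s (a h) t)%:E +
    (~~ psi t)%:R%:E * (tilt s (a' h) t)%:E)%E.
  by apply: emeasurable_funD; [exact: mIt|exact: (mIt (fun t => ~~ psi t))].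
have h0 : 0 <= (#|H|%:R^-1 : R) by rewrite invr_ge0.
rewrite (_ : (\sum_h _)%E = gauss_expect s (fun t => \sum_h (#|H|%:R^-1)%:E *
   ((psi t)%:R%:E * (tilt s (a h) t)%:E + (~~ psi t)%:R%:E * (tilt s (a' h) t)%:E))%E); last first.
  rewrite ge0_gauss_expect_sum; last 2 first.
  - by move=> h; apply: measurable_funeM.
  - by move=> h t; rewrite mule_ge0.
  apply: eq_bigr => h _; rewrite ge0_gauss_expectZl//; congr (_ * _)%E.
  rewrite (ge0_gauss_expectD _ (mIt psi (a h) mpsi) (It0 psi (a h))
    (mIt _ (a' h) mnpsi) (It0 (fun t => ~~ psi t) (a' h))).
  congr (_ + _)%E.
    by rewrite (@gauss_expect_shift _ _ _ _ (fun t => (psi t)%:R%:E))//; [exact: mI|..].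
  by rewrite (@gauss_expect_shift _ _ _ _ (fun t => (~~ psi t)%:R%:E))//; [exact: (mI (fun t => ~~ psi t))|..].
apply: gauss_expect_ge_expfam ef _ _ _.
- by apply: emeasurable_sum => h; exact: measurable_funeM.
- by move=> z; apply: sume_ge0 => h _; rewrite mule_ge0.
(* At each observation exactly one of the two errors occurs, so the integrand is one of the two
   mixture likelihoods, and [f] is below both. *)
- move=> t; case: (psi t) => /=.
    apply: le_trans (_ : (\sum_h #|H|%:R^-1 * vtilt (a h) (tnth t))%:E <= _)%E.
      by rewrite lee_fin; exact: fa.
    by rewrite -sumEFin; apply: lee_sum => h _; rewrite mul1e mul0e adde0.
  apply: le_trans (_ : (\sum_h #|H|%:R^-1 * vtilt (a' h) (tnth t))%:E <= _)%E.
    by rewrite lee_fin; exact: fa'.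
  by rewrite -sumEFin; apply: lee_sum => h _; rewrite mul1e mul0e add0e.
Qed.

End Expfam.


(* [a <= b] is trivial; otherwise this is [(a - 2 * b) ^+ 2 >= 0]. *)
Lemma sub_sqr_div4_le (R : realFieldType) (a b : R) :
  0 < b -> a - (a ^+ 2 / b) / 4 <= b.
Proof.
move=> b0; rewrite lerBlDr -(ler_pM2r b0) mulrDl mulrAC divfK ?gt_eqF//.
have := sqr_ge0 (a - 2 * b); nra.
Qed.

Lemma expRDN_ge2 (R : realType) (x : R) : 2 <= expR x + expR (- x).
Proof. by have := expR_ge1Dx x; have := expR_ge1Dx (- x); lra. Qed.

(** The gap [2 (cosh z - cosh (z rho))] factors. Two factors are bounded by [1 - exp (- x) <= x],
    giving [z (1 - rho)] and at most [2 z]; the third, [exp z], is at most 4. *)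
Lemma expR_cosh_gap (R : realType) (z rho : R) : 0 <= z <= 1 -> 0 <= rho <= 1 ->
  0 <= expR z + expR (- z) - expR (z * rho) - expR (- (z * rho))
    <= 8 * (z ^+ 2 * (1 - rho)).
Proof.
move=> /andP[z0 z1] /andP[r0 r1].
have -> : expR z + expR (- z) - expR (z * rho) - expR (- (z * rho)) =
   expR z * (1 - expR (- (z * (1 - rho)))) * (1 - expR (- (z * (1 + rho)))).
  have E1 : expR (z * rho) = expR z * expR (- (z * (1 - rho))).
    by rewrite -expRD; congr expR; ring.
  have E2 : expR (- (z * rho)) = expR z * expR (- (z * (1 + rho))).
    by rewrite -expRD; congr expR; ring.
  have E3 : expR (- z) = expR z * expR (- (z * (1 - rho))) * expR (- (z * (1 + rho))).
    by rewrite -!expRD; congr expR; ring.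
  by rewrite E1 E2 E3; ring.
have h1 := expR_ge1Dx (- (z * (1 - rho))).
have h2 := expR_ge1Dx (- (z * (1 + rho))).
have h3 : expR (- (z * (1 - rho))) <= 1 by rewrite -[leRHS]expR0 ler_expR oppr_le0 mulr_ge0// subr_ge0.
have h4 : expR (- (z * (1 + rho))) <= 1 by rewrite -[leRHS]expR0 ler_expR oppr_le0 mulr_ge0// addr_ge0.
have e4 : expR z <= 4.
  have h : expR (z / 2) <= 2 by apply: expR_half_le2; lra.
  have := expR_gt0 (z / 2).
  have -> : expR z = expR (z / 2) * expR (z / 2) by rewrite -expRD; congr expR; lra.
  nra.
have e0 := expR_gt0 z.
apply/andP; split; first by rewrite !mulr_ge0 ?subr_ge0// ltW.
have -> : 8 * (z ^+ 2 * (1 - rho)) = 4 * (z * (1 - rho)) * (z * 2) by ring.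
apply: ler_pM.
- by rewrite mulr_ge0 ?subr_ge0// ltW.
- by rewrite subr_ge0.
- by apply: ler_pM => //; [rewrite subr_ge0|lra].
- nra.
Qed.

(** * The two-point test and the sign-mixture test *)

Section Tests.
Context (R : realType) (s : R) (s0 : s != 0).
Local Notation E := (gauss_expect s).
Local Notation vt := (vtilt s).

Let s20 : s ^+ 2 != 0. Proof. by rewrite expf_neq0. Qed.

Lemma vtilt_gt0 n (a y : 'I_n -> R) : 0 < vt a y.
Proof. exact: expR_gt0. Qed.

(** The minorant comes from [sub_sqr_div4_le] applied to the two likelihoods. Its mean is
    [1 - e / 4], where [e <= 2] is one plus the chi-square divergence. *)
Lemma two_point_test n (a a' : 'I_n -> R) (psi : n.-tuple R -> bool) :
  measurable_fun setT psi -> (\sum_i (a i - a' i) ^+ 2) / s ^+ 2 <= 1 / 2 ->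
  ((1 / 2)%:E <= E (fun t => (psi (tshift a t))%:R%:E) +
                 E (fun t => (~~ psi (tshift a' t))%:R%:E))%E.
Proof.
move=> mpsi D.
pose e := expR ((\sum_i (a i - a' i) ^+ 2) / s ^+ 2).
have e2 : e <= 2 by exact: expR_half_le2.
pose f (_ : unit) y : R := 1 * vt a y + (- e / 4) * vt (fun i => 2 * a i - a' i) y.
have ef : expfam s f (fun _ => 1 + - e / 4).
  apply: (@expfamD _ s _ _ (fun _ y => 1 * vt a y) (fun _ y => (- e / 4) * vt (fun i => 2 * a i - a' i) y)).
    exact: (@expfam_vtilt _ _ s0 unit n (fun=> 1) (fun=> a)).
  exact: (@expfam_vtilt _ _ s0 unit n (fun=> - e / 4) (fun=> (fun i => 2 * a i - a' i))).
have fE y : f tt y = vt a y - (vt a y ^+ 2 / vt a' y) / 4.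
  by rewrite /f vtilt_div// -/e; field.
have := @mixture_test _ s s0 n unit (fun=> a) (fun=> a') psi f _ mpsi ef.
have H1 (b : 'I_n -> R) y : \sum_(h : unit) #|{: unit}|%:R^-1 * vt b y = vt b y.
  by rewrite card_unit big_const card_unit/= addr0 invr1 mul1r.
have H2 (x : \bar R) : (\sum_(h : unit) (#|{: unit}|%:R^-1)%:E * x = x)%E.
  by rewrite card_unit big_const card_unit/= adde0 invr1 mul1e.
rewrite H2; move=> /(_ _ _)/(le_trans _); apply.
- rewrite lee_fin; lra.
- move=> y; rewrite H1 fE lerBlDr lerDl.
  by rewrite divr_ge0// divr_ge0 ?sqr_ge0// ltW// vtilt_gt0.
- by move=> y; rewrite H1 fE; apply: sub_sqr_div4_le; exact: vtilt_gt0.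
Qed.

Definition sign_rank1 d1 d2 (u : 'I_d1 -> R) (w : 'I_d2 -> R)
    (eta : {ffun 'I_d2 -> bool}) : 'M[R]_(d1, d2) :=
  \matrix_(i, j) (u i * (w j * (-1) ^+ eta j)).

(** Likelihood ratio of column [j] against pure noise, averaged over the unknown sign of the
    column. *)
Definition col_lik d1 d2 (u : 'I_d1 -> R) (w : 'I_d2 -> R) j (y : 'I_d1 -> R) : R :=
  \sum_(b : bool) 2^-1 * vt (fun i => u i * (w j * (-1) ^+ b)) y.

(** Independent column signs make the columns independent: this is distributivity of the product
    over the two-term sums. *)
Lemma sign_mixture_likelihood d1 d2 (u : 'I_d1 -> R) (w : 'I_d2 -> R) y :
  \sum_(eta : {ffun 'I_d2 -> bool}) #|{: {ffun 'I_d2 -> bool}}|%:R^-1 *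
     vt (mxvec (sign_rank1 u w eta) 0) y =
  \prod_j col_lik u w j (fun i => y (mxvec_index i j)).
Proof.
rewrite bigA_distr_bigA; apply: eq_bigr => eta _ /=.
rewrite big_split/= -expR_sum prodr_const card_ord card_ffun card_bool card_ord.
rewrite natrX exprVn; congr (_ * expR _).
rewrite sum_mxvec_index exchange_big/=.
by apply: eq_bigr => j _; apply: eq_bigr => i _; rewrite mxvecE mxE.
Qed.

Lemma expfam_col_lik d1 d2 (u : 'I_d1 -> R) (w : 'I_d2 -> R) :
  expfam s (col_lik u w) (fun=> 1).
Proof.
have h b := @expfam_vtilt _ _ s0 'I_d2 d1 (fun=> 2^-1) (fun j i => u i * (w j * (-1) ^+ b)).
apply: expfam_ext (expfamD (h true) (h false)) => [j y|j].
  by rewrite /col_lik big_bool.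
by lra.
Qed.

(** The likelihood is the left-hand side times a hyperbolic cosine. The bound replaces a mixture in
    a denominator by a constant. *)
Lemma col_lik_ge d1 d2 (u : 'I_d1 -> R) (w : 'I_d2 -> R) j y :
  \sum_i u i ^+ 2 = 1 -> expR (- (w j ^+ 2 / s ^+ 2 / 2)) <= col_lik u w j y.
Proof.
move=> u1; rewrite /col_lik big_bool/= expr1 expr0.
pose x := (\sum_i u i * y i) * w j / s ^+ 2.
have h (b : bool) : vt (fun i => u i * (w j * (-1) ^+ b)) y =
    expR (- (w j ^+ 2 / s ^+ 2 / 2)) * expR ((-1) ^+ b * x).
  rewrite -expRD; congr expR.
  have -> : w j ^+ 2 = (\sum_i u i ^+ 2) * w j ^+ 2 by rewrite u1 mul1r.
  rewrite /x !mulr_suml mulr_sumr -sumrN -big_split/=.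
  apply: eq_bigr => i _.
  by case: b; rewrite ?expr1 ?expr0; field.
have := h true; have := h false; rewrite expr1 expr0 => -> ->.
rewrite mul1r mulN1r; have := expRDN_ge2 x; have := expR_gt0 (- (w j ^+ 2 / s ^+ 2 / 2)).
nra.
Qed.

Lemma expfam_col_lik_gap d1 d2 (u u' : 'I_d1 -> R) (w : 'I_d2 -> R) rho :
  \sum_i u i ^+ 2 = 1 -> \sum_i u' i ^+ 2 = 1 -> \sum_i u i * u' i = rho ->
  expfam s (fun j y => (col_lik u w j y - col_lik u' w j y) ^+ 2)
    (fun j => let z := w j ^+ 2 / s ^+ 2 in
       expR z + expR (- z) - expR (z * rho) - expR (- (z * rho))).
Proof.
move=> u1 u'1 uu'.
(* The first boolean selects the hypothesis, the second the sign. Inner products over [s ^+ 2] are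
   then [z] or [- z] within a hypothesis, and [z * rho] or its opposite across. *)
pose al (j : 'I_d2) (p : bool * bool) i := (if p.1 then u i else u' i) * (w j * (-1) ^+ p.2).
pose c (p : bool * bool) : R := if p.1 then 2^-1 else - 2^-1.
apply: expfam_ext (expfam_sqr s0 (fun=> c) al) => [j y|j].
  congr (_ ^+ 2); rewrite -(pair_bigA _ (fun a b => c (a, b) * vt (al j (a, b)) y))/=.
  rewrite big_bool/= /col_lik !big_bool/= /c/=.
  by ring.
pose z := w j ^+ 2 / s ^+ 2.
have G p q : (\sum_i al j p i * al j q i) / s ^+ 2 =
    z * (if p.1 == q.1 then 1 else rho) * ((-1) ^+ p.2 * (-1) ^+ q.2).
  have -> : \sum_i al j p i * al j q i = (if p.1 == q.1 then 1 else rho) *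
      (w j ^+ 2 * ((-1) ^+ p.2 * (-1) ^+ q.2)).
    rewrite (_ : (if _ then _ else _) = \sum_i (if p.1 then u i else u' i) * (if q.1 then u i else u' i)).
      by rewrite mulr_suml; apply: eq_bigr => i _; rewrite /al; ring.
    case: (p.1); case: (q.1) => /=; first by rewrite -[LHS]u1.
    - by rewrite uu'.
    - by rewrite -uu'; apply: eq_bigr => i _; rewrite mulrC.
    - by rewrite -[LHS]u'1.
  by rewrite /z; field.
under eq_bigr => p _ do under eq_bigr => q _ do rewrite G.
rewrite -(pair_bigA _ (fun a b => \sum_q c (a, b) * c q *
   expR (z * (if (a, b).1 == q.1 then 1 else rho) * ((-1) ^+ (a, b).2 * (-1) ^+ q.2))))/=.
have S a b : \sum_q c (a, b) * c q *
   expR (z * (if a == q.1 then 1 else rho) * ((-1) ^+ b * (-1) ^+ q.2)) =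
   \sum_a' \sum_b' c (a, b) * c (a', b') *
   expR (z * (if a == a' then 1 else rho) * ((-1) ^+ b * (-1) ^+ (b' : bool))).
  by rewrite pair_bigA.
under eq_bigr => a _ do under eq_bigr => b _ do rewrite S.
rewrite !big_bool/= /c/= -/z expr1 expr0.
by rewrite !(mulrN1, mulN1r, mulr1, opprK); field.
Qed.

(** With [a] and [b] the column likelihoods, [a^2 / b = 2 a - b + (a - b)^2 / b] is not a sum of
    exponentials, but [1 / b <= C] gives the majorant [G], which is one. The minorant for
    [sub_sqr_div4_le] uses the product of the [G j] in place of the squared ratio. *)
Lemma sign_mixture_test d1 d2 (u u' : 'I_d1 -> R) (w : 'I_d2 -> R) rho
    (psi : (d1 * d2).-tuple R -> bool) :
  measurable_fun setT psi ->
  \sum_i u i ^+ 2 = 1 -> \sum_i u' i ^+ 2 = 1 -> \sum_i u i * u' i = rho ->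
  0 <= rho <= 1 -> (forall j, w j ^+ 2 / s ^+ 2 <= 1) ->
  \sum_j 16 * ((w j ^+ 2 / s ^+ 2) ^+ 2 * (1 - rho)) <= 1 / 2 ->
  ((1 / 2)%:E <= \sum_(eta : {ffun 'I_d2 -> bool})
     (#|{: {ffun 'I_d2 -> bool}}|%:R^-1)%:E *
     (E (fun t => (psi (tshift (mxvec (sign_rank1 u w eta) 0) t))%:R%:E) +
      E (fun t => (~~ psi (tshift (mxvec (sign_rank1 u' w eta) 0) t))%:R%:E)))%E.
Proof.
move=> mpsi u1 u'1 uu' rho01 z1 kap.
pose z j := w j ^+ 2 / s ^+ 2.
have z0 j : 0 <= z j by rewrite divr_ge0 ?sqr_ge0.
pose C j := expR (z j / 2).
pose a := col_lik u w; pose b := col_lik u' w.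
pose g j := expR (z j) + expR (- z j) - expR (z j * rho) - expR (- (z j * rho)).
pose G j y := (2 * a j y + (-1) * b j y) + C j * (a j y - b j y) ^+ 2.
have ea : expfam s a (fun=> 1) := expfam_col_lik u w.
have eb : expfam s b (fun=> 1) := expfam_col_lik u' w.
have eG : expfam s G (fun j => (2 * 1 + (-1) * 1) + C j * g j).
  apply: expfamD; last by apply: expfamZ; exact: expfam_col_lik_gap.
  by apply: expfamD; apply: expfamZ.
pose f (_ : unit) (y : 'I_(d1 * d2) -> R) :=
  \prod_j a j (fun i => y (mxvec_index i j)) +
  (- 4^-1) * \prod_j G j (fun i => y (mxvec_index i j)).
have ef := expfamD (expfam_prod ea) (expfamZ (fun=> - 4^-1) (expfam_prod eG)).
have apos j y : 0 < a j y by apply: lt_le_trans (col_lik_ge w j y u1); exact: expR_gt0.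
have bge j y : (C j)^-1 <= b j y by rewrite /C -expRN; exact: col_lik_ge.
have C0 j : 0 < C j by exact: expR_gt0.
have bpos j y : 0 < b j y by apply: lt_le_trans (bge j y); rewrite invr_gt0.
have abG j y : a j y ^+ 2 / b j y <= G j y.
  have -> : a j y ^+ 2 / b j y = (2 * a j y + (-1) * b j y) + (b j y)^-1 * (a j y - b j y) ^+ 2.
    by field; rewrite gt_eqF.
  rewrite lerD2l ler_wpM2r ?sqr_ge0//.
  by rewrite -(invrK (C j)) lef_pV2// posrE ?invr_gt0.
have ab0 j y : 0 <= a j y ^+ 2 / b j y by rewrite divr_ge0 ?sqr_ge0// ltW.
have G0 j y : 0 <= G j y by exact: le_trans (abG j y).
have := @mixture_test _ s s0 _ {ffun 'I_d2 -> bool}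
  (fun eta => mxvec (sign_rank1 u w eta) 0) (fun eta => mxvec (sign_rank1 u' w eta) 0)
  psi f _ mpsi ef.
move=> /(_ _ _)/(le_trans _); apply.
(* The mean of the minorant is [1 - P / 4]. *)
- rewrite lee_fin big1//; set P := \prod_j _.
  suff : P <= 2 by lra.
  rewrite /P (eq_bigr (fun j => 1 + C j * g j)); last by move=> j _; lra.
  have gb j : 0 <= g j <= 8 * (z j ^+ 2 * (1 - rho)).
    by apply: expR_cosh_gap => //; rewrite z0 z1.
  apply: prod1D_le2 => [|j]; last first.
    by have /andP[g0 _] := gb j; rewrite mulr_ge0// ltW.
  apply: le_trans kap; apply: ler_sum => j _.
  (* The 2 bounds [C j], the 8 comes from [expR_cosh_gap]. *)
  have -> : 16 * ((w j ^+ 2 / s ^+ 2) ^+ 2 * (1 - rho)) = 2 * (8 * (z j ^+ 2 * (1 - rho))).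
    by rewrite /z; lra.
  have /andP[g0 g8] := gb j.
  apply: ler_pM => //; first exact: ltW.
  by apply: expR_half_le2; have := z1 j; rewrite -/(z j); lra.
- move=> y; rewrite sign_mixture_likelihood /f mulNr lerBlDr lerDl.
  by rewrite mulr_ge0 ?invr_ge0// prodr_ge0.
- move=> y; rewrite sign_mixture_likelihood.
  apply: le_trans (@sub_sqr_div4_le _ (\prod_j a j (fun i => y (mxvec_index i j))) _ _); last first.
    by rewrite prodr_gt0.
  rewrite /f lerD2l mulNr lerN2 [leRHS]mulrC ler_pM2r ?invr_gt0//.
  rewrite -prodrXl -prodf_div; apply: ler_prod => j _.
  by rewrite ab0 abG.
Qed.

End Tests.


(** * Norms and rotation-invariant decoding *)

Section Norms.
Context (R : realType).

(** Cauchy-Schwarz: the nonnegative quadratic form [H] takes the value [B (A B - C^2)] at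
    [(B, - C)]. *)
Lemma sqr_sum_mul_le (I : finType) (a b : I -> R) :
  (\sum_i a i * b i) ^+ 2 <= (\sum_i a i ^+ 2) * (\sum_i b i ^+ 2).
Proof.
set A := \sum_i a i ^+ 2; set B := \sum_i b i ^+ 2; set C := \sum_i a i * b i.
have A0 : 0 <= A by apply: sumr_ge0 => i _; exact: sqr_ge0.
have B0 : 0 <= B by apply: sumr_ge0 => i _; exact: sqr_ge0.
have H x y : 0 <= x ^+ 2 * A + 2 * x * y * C + y ^+ 2 * B.
  rewrite /A /B /C !mulr_sumr -!big_split/=; apply: sumr_ge0 => i _.
  by rewrite (_ : _ + _ = (x * a i + y * b i) ^+ 2) ?sqr_ge0//; ring.
have [B1|B1] := eqVneq B 0.
  have Hb i : b i = 0.
    move/eqP: B1; rewrite psumr_eq0 => [|j _]; last exact: sqr_ge0.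
    by move=> /allP/(_ i (mem_index_enum i)); rewrite implyTb sqrf_eq0 => /eqP.
  by rewrite /C big1 ?expr0n ?mulr_ge0// => i _; rewrite Hb mulr0.
have Bp : 0 < B by rewrite lt_def B1.
have h := H B (- C).
rewrite -subr_ge0 -(pmulr_rge0 _ Bp); apply: le_trans h _.
by rewrite le_eqVlt; apply/orP; left; apply/eqP; ring.
Qed.

Lemma vnorm2_ge0 n (v : 'cV[R]_n) : 0 <= vnorm2 v.
Proof. exact: sqrtr_ge0. Qed.

Lemma sqr_vnorm2 n (v : 'cV[R]_n) : vnorm2 v ^+ 2 = \sum_i v i 0 ^+ 2.
Proof. by rewrite sqr_sqrtr// sumr_ge0// => i _; exact: sqr_ge0. Qed.

Lemma vnorm2Z n (c : R) (v : 'cV[R]_n) : vnorm2 (c *: v) = `|c| * vnorm2 v.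
Proof.
rewrite /vnorm2 -sqrtr_sqr -sqrtrM ?sqr_ge0//; congr Num.sqrt.
by rewrite mulr_sumr; apply: eq_bigr => i _; rewrite mxE exprMn.
Qed.

Lemma vnorm2_mulmx_sqr_le m n (M : 'M[R]_(m, n)) (x : 'cV[R]_n) :
  vnorm2 (M *m x) ^+ 2 <= (\sum_i \sum_j M i j ^+ 2) * vnorm2 x ^+ 2.
Proof.
rewrite !sqr_vnorm2 mulr_suml; apply: ler_sum => i _.
by rewrite mxE; exact: sqr_sum_mul_le.
Qed.

Lemma vnorm2_mulmx_le_spec m n (M : 'M[R]_(m, n)) (x : 'cV[R]_n) :
  vnorm2 (M *m x) <= spec_norm M * vnorm2 x.
Proof.
have [x0|x0] := eqVneq (vnorm2 x) 0.
  have := vnorm2_mulmx_sqr_le M x.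
  by rewrite x0 expr0n !mulr0 real_exprn_even_le0 ?num_real// => /eqP ->.
have xp : 0 < vnorm2 x by rewrite lt_def x0 vnorm2_ge0.
rewrite -ler_pdivrMr//.
apply: ub_le_sup; last first.
  exists ((vnorm2 x)^-1 *: x) => /=.
    by rewrite vnorm2Z ger0_norm ?invr_ge0 ?vnorm2_ge0// mulVf.
  by rewrite -scalemxAr vnorm2Z ger0_norm ?invr_ge0 ?vnorm2_ge0// mulrC.
(* The Frobenius norm bounds the set under the [sup]. *)
exists (Num.sqrt (\sum_i \sum_j M i j ^+ 2)) => _ [y /= y1 <-].
rewrite -(@ler_pXn2r _ 2) ?nnegrE ?vnorm2_ge0 ?sqrtr_ge0//.
rewrite [leRHS]sqr_sqrtr; last first.
  by apply: sumr_ge0 => i _; apply: sumr_ge0 => j _; exact: sqr_ge0.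
by apply: le_trans (vnorm2_mulmx_sqr_le M y) _; rewrite y1 expr1n mulr1.
Qed.

(** The squared Frobenius norm is a sum of [m] squared row norms. This factor [sqrt m] becomes the
    [1 / sqrt d1] of the two-to-infinity bound. *)
Lemma vnorm2_mulmx_le_two_inf m n (M : 'M[R]_(m, n)) (x : 'cV[R]_n) :
  vnorm2 (M *m x) <= Num.sqrt m%:R * two_inf_norm M * vnorm2 x.
Proof.
have t0 : 0 <= two_inf_norm M by apply: bigmax_ge_id.
rewrite -(@ler_pXn2r _ 2) ?nnegrE ?vnorm2_ge0 ?mulr_ge0 ?sqrtr_ge0 ?vnorm2_ge0//.
apply: le_trans (vnorm2_mulmx_sqr_le M x) _.
rewrite [leRHS]exprMn ler_wpM2r ?sqr_ge0// exprMn sqr_sqrtr ?ler0n//.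
apply: (@le_trans _ _ (\sum_(i < m) two_inf_norm M ^+ 2)); last first.
  by rewrite sumr_const card_ord mulr_natl.
apply: ler_sum => i _.
rewrite -[leLHS]sqr_sqrtr; last by apply: sumr_ge0 => ? _; exact: sqr_ge0.
rewrite ler_pXn2r ?nnegrE ?sqrtr_ge0//.
by rewrite /two_inf_norm; apply: (le_bigmax _ (fun i => Num.sqrt (\sum_j M i j ^+ 2))).
Qed.

(** Applied to the transposed row [i], [M] produces the squared row norm [nu] as its entry [i],
    whence [nu^2 <= delta^2 nu]. *)
Lemma row_sqr_le_op m n (M : 'M[R]_(m, n)) (delta : R) (i : 'I_m) : 0 <= delta ->
  (forall x, vnorm2 (M *m x) <= delta * vnorm2 x) ->
  \sum_j M i j ^+ 2 <= delta ^+ 2.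
Proof.
move=> d0 H; set nu := \sum_j _.
have nu0 : 0 <= nu by apply: sumr_ge0 => j _; exact: sqr_ge0.
pose x := (row i M)^T.
have x2 : vnorm2 x ^+ 2 = nu.
  by rewrite sqr_vnorm2; apply: eq_bigr => j _; rewrite !mxE.
have Mx : (M *m x) i 0 = nu.
  by rewrite mxE; apply: eq_bigr => j _; rewrite !mxE -expr2.
have h : nu ^+ 2 <= delta ^+ 2 * nu.
  apply: (@le_trans _ _ (vnorm2 (M *m x) ^+ 2)).
    rewrite sqr_vnorm2 (bigD1 i)//= Mx lerDl; apply: sumr_ge0 => j _; exact: sqr_ge0.
  by rewrite -x2 -exprMn ler_pXn2r ?nnegrE ?mulr_ge0 ?vnorm2_ge0.
have [->|n0] := eqVneq nu 0; first exact: sqr_ge0.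
have np : 0 < nu by rewrite lt_def n0.
by rewrite -(ler_pM2r np) -expr2.
Qed.

End Norms.

Section Loss.
Context (R : realType).

Definition wrong_sign d r m (i0 : 'I_d) (ik : 'I_m -> 'I_d) (Uh : 'M[R]_(d, r))
    (eps : {ffun 'I_m -> bool}) (k : 'I_m) : bool :=
  (0 < \sum_b Uh (ik k) b * Uh i0 b) != eps k.

(* The sign of [(Uh Uh^T) (ik k) i0] is insensitive to the rotation; if it is
   wrong for many [k] then [Uh Q - U] moves the vector [y = (Uh Q)^T e_{i0}],
   which is close to [a e_l], by a large amount. *)
Lemma wrong_sign_loss d r m (nrm : 'M[R]_(d, r) -> R) (C : R)
    (U Uh : 'M[R]_(d, r)) (Q : 'M[R]_r)
    (i0 : 'I_d) (l : 'I_r) (ik : 'I_m -> 'I_d) (eps : {ffun 'I_m -> bool}) (a q : R) :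
  0 < C -> (forall M, 0 <= nrm M) ->
  (forall M x, vnorm2 (M *m x) <= C * nrm M * vnorm2 x) ->
  orthogonal_mx Q -> (0 < m)%N -> injective ik -> 0 < q -> q <= a ->
  (forall j, U i0 j = a * (j == l)%:R) ->
  (forall k j, U (ik k) j =
     (if eps k then 1 else -1) * (q / Num.sqrt m%:R) * (j == l)%:R) ->
  q / (3 * C * m%:R) * \sum_k (wrong_sign i0 ik Uh eps k)%:R <= nrm (Uh *m Q - U).
Proof.
move=> C0 nrm0 Hn oQ m0 iki q0 qa U0 Uk.
set M := Uh *m Q - U; set h := \sum_k _.
pose delta := C * nrm M.
have d0 : 0 <= delta by rewrite mulr_ge0// ltW.
have HM x : vnorm2 (M *m x) <= delta * vnorm2 x by exact: Hn.
have mR : 0 < m%:R :> R by rewrite ltr0n.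
have hm : h <= m%:R.
  rewrite /h -[leRHS]mulr1 mulr_natl -[in leRHS](card_ord m) -sumr_const.
  by apply: ler_sum => k _; rewrite lern1 leq_b1.
have h0 : 0 <= h by apply: sumr_ge0 => k _; rewrite ler0n.
suff key : q * (h / m%:R) <= 3 * delta.
  rewrite (_ : _ * h = q * (h / m%:R) / (3 * C)); last by field; rewrite !gt_eqF.
  by rewrite ler_pdivrMr ?mulr_gt0// [leRHS]mulrC -mulrA.
have hm1 : h / m%:R <= 1 by rewrite ler_pdivrMr// mul1r.
have hm0 : 0 <= h / m%:R by rewrite divr_ge0// ltW.
(* A large [delta] settles the claim, since [q * (h / m) <= q <= a < 2 * delta]. *)
have [da|da] := ltP (a / 2) delta.
  by nra.
pose W := Uh *m Q.
have WE i j : W i j = U i j + M i j by rewrite /M !mxE; ring.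
pose y : 'cV[R]_r := \col_b W i0 b.
have nu := row_sqr_le_op i0 d0 HM.
have Ml : M i0 l ^+ 2 <= delta ^+ 2.
  by apply: le_trans nu; rewrite (bigD1 l)//= lerDl sumr_ge0// => j _; exact: sqr_ge0.
have Ml1 : `|M i0 l| <= delta.
  by rewrite -(@ler_pXn2r _ 2) ?nnegrE// real_normK// num_real.
have {Ml1}/andP[Ml1 Ml2] : - delta <= M i0 l <= delta by rewrite -ler_norml.
have a0 : 0 < a by exact: lt_le_trans qa.
(* [y] is [a e_l] plus a row of [M] of norm at most [a / 2]. *)
have y2 : vnorm2 y ^+ 2 <= 9 / 4 * a ^+ 2.
  rewrite sqr_vnorm2.
  have -> : \sum_i y i 0 ^+ 2 = a ^+ 2 + 2 * a * M i0 l + \sum_j M i0 j ^+ 2.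
    have -> : a ^+ 2 + 2 * a * M i0 l = \sum_j (a * (j == l)%:R) * (a * (j == l)%:R + 2 * M i0 j).
      rewrite (bigD1 l)//= eqxx mulr1 big1 ?addr0; first by ring.
      by move=> j /negbTE ->; rewrite mulr0 mul0r.
    by rewrite -big_split/=; apply: eq_bigr => j _; rewrite mxE WE U0; ring.
  nra.
have yl : a / 2 <= y l 0 by rewrite mxE WE U0 eqxx mulr1; lra.
have WW : W *m W^T = Uh *m Uh^T.
  by rewrite /W trmx_mul mulmxA -(mulmxA Uh) (mulmx1C oQ) mulmx1.
pose g := q / Num.sqrt m%:R.
have g2 : g ^+ 2 = q ^+ 2 / m%:R by rewrite /g expr_div_n sqr_sqrtr// ltW.
have g0 : 0 < g by rewrite divr_gt0// sqrtr_gt0.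
(* The entry is the decoded quantity minus the signed [g * y l 0]. A wrong sign rules out
   cancellation, leaving at least [g * a / 2] in absolute value. *)
have wr k : (wrong_sign i0 ik Uh eps k)%:R * (g * a / 2) ^+ 2 <= (M *m y) (ik k) 0 ^+ 2.
  have [w|_] := boolP (wrong_sign i0 ik Uh eps k); last by rewrite mul0r sqr_ge0.
  rewrite mul1r.
  have -> : (M *m y) (ik k) 0 = (\sum_b Uh (ik k) b * Uh i0 b) -
      (if eps k then 1 else -1) * g * y l 0.
    have -> : \sum_b Uh (ik k) b * Uh i0 b = \sum_b W (ik k) b * y b 0.
      transitivity ((Uh *m Uh^T) (ik k) i0).
        by rewrite mxE; apply: eq_bigr => b _; rewrite mxE.
      by rewrite -WW mxE; apply: eq_bigr => b _; rewrite !mxE.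
    have -> : (if eps k then 1 else -1) * g * y l 0 = \sum_b U (ik k) b * y b 0.
      rewrite (bigD1 l)//= Uk eqxx mulr1 big1 ?addr0// => b /negbTE bl.
      by rewrite Uk bl mulr0 mul0r.
    rewrite mxE -sumrB; apply: eq_bigr => b _; rewrite WE; ring.
  have ga : 0 <= g * a / 2 <= g * y l 0.
    by rewrite -mulrA ler_pM2l// yl andbT mulr_ge0 ?ltW// divr_gt0.
  move: w ga; rewrite /wrong_sign; set S := \sum_b _.
  case: (eps k) => /=; case: (ltP 0 S) => //= S0 _ /andP[ga0 ga]; nra.
have big : h * (g * a / 2) ^+ 2 <= delta ^+ 2 * (9 / 4 * a ^+ 2).
  apply: (@le_trans _ _ (vnorm2 (M *m y) ^+ 2)).
    rewrite sqr_vnorm2 /h mulr_suml.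
    apply: (@le_trans _ _ (\sum_k (M *m y) (ik k) 0 ^+ 2)).
      by apply: ler_sum => k _; exact: wr.
    rewrite -(big_image _ _ ik predT (fun i => (M *m y) i 0 ^+ 2))/=.
    rewrite big_uniq/=; last by rewrite map_inj_uniq// enum_uniq.
    rewrite [leRHS](bigID (mem [seq ik k | k <- enum 'I_m]))/= lerDl.
    by apply: sumr_ge0 => i _; exact: sqr_ge0.
  apply: (@le_trans _ _ ((delta * vnorm2 y) ^+ 2)).
    by rewrite ler_pXn2r ?nnegrE ?(mulr_ge0 d0) ?vnorm2_ge0//; exact: HM.
  by rewrite exprMn ler_wpM2l ?sqr_ge0.
have big2 : h * g ^+ 2 <= (3 * delta) ^+ 2.
  have ap : 0 < a ^+ 2 / 4 by rewrite divr_gt0// exprn_gt0.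
  rewrite -(ler_pM2r ap).
  have -> : h * g ^+ 2 * (a ^+ 2 / 4) = h * (g * a / 2) ^+ 2 by field.
  have -> // : (3 * delta) ^+ 2 * (a ^+ 2 / 4) = delta ^+ 2 * (9 / 4 * a ^+ 2) by field.
(* Since [h / m <= 1], its square is at most itself, which matches the linear dependence on [h] in
   [big2]. *)
rewrite -(@ler_pXn2r _ 2) ?nnegrE ?(mulr_ge0 _ d0) ?mulr_ge0 ?(ltW q0)//.
apply: le_trans big2; rewrite g2 exprMn expr2 [(h / _) ^+ 2]expr2.
have -> : h * (q ^+ 2 / m%:R) = q * q * (h / m%:R) by field; rewrite gt_eqF.
rewrite ler_wpM2l ?(mulr_ge0 (ltW q0) (ltW q0))//.
by rewrite -[leRHS]mulr1 ler_wpM2l.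
Qed.

Lemma le_rot_loss d r (nrm : 'M[R]_(d, r) -> R) (Uh U : 'M[R]_(d, r)) (c : R) :
  (forall Q, orthogonal_mx Q -> c <= nrm (Uh *m Q - U)) -> c <= rot_loss nrm Uh U.
Proof.
move=> H; apply: lb_le_inf; last by move=> _ [Q /= oQ <-]; exact: H.
by exists (nrm (Uh *m 1%:M - U)); exists 1%:M => //=; rewrite /orthogonal_mx trmx1 mulmx1.
Qed.

End Loss.


(** * Assouad's lemma for the sampled model *)

Section Bernoulli.
Context (R : realType) (d1 d2 : nat) (p : R).
Local Notation mask := {ffun 'I_d1 * 'I_d2 -> bool}.

Lemma bern_weight_ge0 (Om : mask) : 0 <= p <= 1 -> 0 <= bern_weight p Om.
Proof.
move=> /andP[p0 p1]; apply: prodr_ge0 => k _.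
by case: (Om k) => //; rewrite subr_ge0.
Qed.

Lemma sum_bern_weight : \sum_(Om : mask) bern_weight p Om = 1.
Proof.
rewrite /bern_weight -(bigA_distr_bigA (fun _ b => if b then p else 1 - p)).
by rewrite big1// => k _; rewrite big_bool/=; ring.
Qed.

Lemma sum_bern_weight_unobserved (e : 'I_d1 * 'I_d2) :
  \sum_(Om : mask) bern_weight p Om * (~~ Om e)%:R = 1 - p.
Proof.
pose F k (b : bool) := (if b then p else 1 - p) * (if k == e then (~~ b)%:R else 1).
transitivity (\sum_(Om : mask) \prod_k F k (Om k)).
  apply: eq_bigr => Om _; rewrite big_split/=; congr (_ * _).
  by rewrite (bigD1 e)//= eqxx big1 ?mulr1// => k /negbTE ->.
rewrite -bigA_distr_bigA (bigD1 e)//= [X in _ * X]big1 ?mulr1 => [|k /negbTE ke].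
  by rewrite big_bool /F eqxx/= mulr0 mulr1 add0r.
by rewrite big_bool /F ke/=; ring.
Qed.

End Bernoulli.

Section Observation.
Context (R : realType).

Lemma addmx_tuple_mx d1 d2 (A : 'M[R]_(d1, d2)) t :
  A + tuple_mx t = tuple_mx (tshift (mxvec A 0) t).
Proof. by apply/matrixP => i j; rewrite !mxE tnth_tshift mxvecE addrC. Qed.

Lemma measurable_estimator_obs d1 d2 r
    (Uhat : {ffun 'I_d1 * 'I_d2 -> bool} -> 'M[R]_(d1, d2) -> 'M[R]_(d1, r)) Om A a b :
  estimator_measurable Uhat ->
  measurable_fun setT (fun t => Uhat Om (P_Omega Om (A + tuple_mx t)) a b).
Proof.
move=> mU.
pose row (l : 'I_(d1 * d2)) := (enum_val (cast_ord (esym (mxvec_cast d1 d2)) l)).1.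
pose col (l : 'I_(d1 * d2)) := (enum_val (cast_ord (esym (mxvec_cast d1 d2)) l)).2.
pose g (t : (d1 * d2).-tuple R) : (d1 * d2).-tuple R :=
  [tuple (if Om (row l, col l) then A (row l) (col l) + tnth t l else 0) | l < d1 * d2].
have gE t : P_Omega Om (A + tuple_mx t) = tuple_mx (g t).
  apply/matrixP => i j; rewrite !mxE tnth_mktuple /row /col /mxvec_index.
  by rewrite cast_ordK enum_rankK.
under eq_fun do rewrite gE.
apply: (measurableT_comp (mU Om a b)).
apply/measurable_fun_tnthP => l.
rewrite (_ : _ \o _ = fun t : (d1 * d2).-tuple R =>
    if Om (row l, col l) then A (row l) (col l) + tnth t l else 0); last first.
  by apply/funext => t /=; rewrite tnth_mktuple.
case: (Om _) => //; apply: measurable_funD => //; exact: measurable_tnth.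
Qed.

End Observation.

Lemma ereal_ge_average (R : realType) (I : finType) (x : I -> R) (W : \bar R) (y : R) :
  (0 < #|I|)%N -> (forall i, ((x i)%:E <= W)%E) ->
  #|I|%:R * y <= \sum_i x i -> (y%:E <= W)%E.
Proof.
move=> /card_gt0P[i0 _] xW yx.
pose i := [arg max_(i > i0) x i]%O.
apply: le_trans (xW i); rewrite lee_fin.
have I0 : 0 < #|I|%:R :> R by rewrite ltr0n; apply/card_gt0P; exists i0.
rewrite -(ler_pM2l I0); apply: le_trans yx _.
rewrite mulr_natl -sumr_const; apply: ler_sum => j _.
by rewrite /i; case: arg_maxP => // k _; apply.
Qed.

Definition flip m (k : 'I_m) (eps : {ffun 'I_m -> bool}) : {ffun 'I_m -> bool} :=
  [ffun l => if l == k then ~~ eps l else eps l].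

Lemma flipK m (k : 'I_m) : involutive (flip k).
Proof. by move=> eps; apply/ffunP => l; rewrite !ffunE; case: eqP => // _; rewrite negbK. Qed.

(** The worst risk dominates the average over all [eps] and [eta]. For each coordinate, pairing
    [eps] with [flip k eps] turns the average error into half a sum of testing errors. The 4
    combines this half with the 1/2 bounding the mean of [kap] over masks. *)
Lemma assouad (R : realType) d1 d2 r m (H : finType) (sigma p sstar : R)
    (nrm : 'M[R]_(d1, r) -> R)
    (Uhat : {ffun 'I_d1 * 'I_d2 -> bool} -> 'M[R]_(d1, d2) -> 'M[R]_(d1, r))
    (A : {ffun 'I_m -> bool} -> H -> 'M[R]_(d1, d2))
    (U : {ffun 'I_m -> bool} -> 'M[R]_(d1, r))
    (dec : 'I_m -> 'M[R]_(d1, r) -> bool) (c : R)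
    (kap : 'I_m -> {ffun 'I_d1 * 'I_d2 -> bool} -> R) :
  0 <= p <= 1 -> 0 <= c -> (0 < #|H|)%N ->
  (forall eps eta, Mstar_U sstar (A eps eta) (U eps)) ->
  (forall (eps : {ffun 'I_m -> bool}) Uh, c * \sum_k (dec k Uh != eps k)%:R <= rot_loss nrm Uh (U eps)) ->
  (forall Om B k, measurable_fun setT
     (fun t => dec k (Uhat Om (P_Omega Om (B + tuple_mx t))))) ->
  (forall (eps : {ffun 'I_m -> bool}) k Om, ((kap k Om)%:E <= \sum_eta (#|H|%:R^-1)%:E *
     (gauss_expect sigma (fun t =>
        (dec k (Uhat Om (P_Omega Om (A eps eta + tuple_mx t))) != eps k)%:R%:E) +
      gauss_expect sigma (fun t =>
        (dec k (Uhat Om (P_Omega Om (A (flip k eps) eta + tuple_mx t)))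
            != flip k eps k)%:R%:E)))%E) ->
  (forall k, 1 / 2 <= \sum_Om bern_weight p Om * kap k Om) ->
  ((c * m%:R / 4)%:E <= worst_risk sigma p sstar nrm Uhat)%E.
Proof.
move=> p01 c0 H0 hM hloss hmeas htest hkap.
pose err (eps : {ffun 'I_m -> bool}) eta k Om t : bool :=
  dec k (Uhat Om (P_Omega Om (A eps eta + tuple_mx t))) != eps k.
pose Te eps eta k Om := gauss_expect sigma (fun t => (err eps eta k Om t)%:R%:E : \bar R).
have Te0 eps eta k Om : (0 <= Te eps eta k Om)%E.
  by apply: gauss_expect_ge0 => t; rewrite lee_fin ler0n.
have Te1 eps eta k Om : (Te eps eta k Om <= 1)%E.
  rewrite -(gauss_expect_cst sigma (d1 * d2) 1); apply: le_gauss_expect => t.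
    by rewrite lee_fin ler0n.
  by rewrite lee_fin lern1 leq_b1.
(* The error probabilities lie in [[0, 1]], so the averaging can be carried out in [R]. *)
pose T eps eta k Om := fine (Te eps eta k Om).
have TE eps eta k Om : Te eps eta k Om = (T eps eta k Om)%:E.
  rewrite /T fineK// ge0_fin_numE//; apply: le_lt_trans (Te1 _ _ _ _) _.
  by rewrite ltry.
have merr eps eta k Om : measurable_fun setT (fun t => ((err eps eta k Om t)%:R : R)%:E).
  apply/measurable_EFinP.
  rewrite (_ : (fun t => _) = (fun t => if dec k (Uhat Om (P_Omega Om (A eps eta + tuple_mx t)))
     then (~~ eps k)%:R else (eps k)%:R : R)); last first.
    by apply/funext => t; rewrite /err; case: (dec _ _); case: (eps k).
  by apply: measurable_fun_ifT => //; exact: hmeas.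
pose X (i : {ffun 'I_m -> bool} * H) :=
  \sum_Om bern_weight p Om * (c * \sum_k T i.1 i.2 k Om).
apply: (@ereal_ge_average _ ({ffun 'I_m -> bool} * H)%type X).
- rewrite card_prod muln_gt0 H0 andbT; apply/card_gt0P; by exists [ffun=> true].
- move=> [eps eta] /=.
  apply: (@le_trans _ _ (risk sigma p nrm Uhat (A eps eta) (U eps))); last first.
    by apply: ereal_sup_ubound => /=; exists (A eps eta), (U eps).
  rewrite /X /risk -sumEFin; apply: lee_sum => Om _; rewrite EFinM.
  apply: lee_wpmul2l; first by rewrite lee_fin bern_weight_ge0.
  rewrite EFinM -sumEFin.
  rewrite (_ : (_ * _)%E = gauss_expect sigma (fun t => c%:E *
      \sum_k (err eps eta k Om t)%:R%:E)%E); last first.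
    rewrite ge0_gauss_expectZl//; last 2 first.
    + by apply: emeasurable_sum.
    + by move=> t; apply: sume_ge0 => k _; rewrite lee_fin ler0n.
    rewrite ge0_gauss_expect_sum//.
    by congr (_ * _)%E; apply: eq_bigr => k _; rewrite -TE.
  apply: le_gauss_expect => t; rewrite sumEFin -EFinM lee_fin.
    by rewrite mulr_ge0// sumr_ge0// => k _; rewrite ler0n.
  exact: hloss.
- have pair_T k Om : #|{: {ffun 'I_m -> bool} * H}|%:R * (kap k Om / 2) <=
      \sum_eps \sum_eta T eps eta k Om.
    rewrite -(ler_pM2r (ltr0n R 2)) -mulrA divfK// mulr_natr mulr2n.
    rewrite [X in _ <= _ + X](reindex_inj (inv_inj (flipK k)))/=.
    rewrite -big_split/= card_prod natrM -mulrA mulr_natl -sumr_const.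
    apply: ler_sum => eps _; rewrite -big_split/=.
    have := htest eps k Om.
    rewrite (_ : (\sum_eta _)%E = (#|H|%:R^-1 * \sum_eta (T eps eta k Om + T (flip k eps) eta k Om))%:E).
      rewrite lee_fin -(ler_pM2l (_ : 0 < #|H|%:R))// ?ltr0n//.
      by rewrite mulVKf// pnatr_eq0 -lt0n.
    rewrite mulr_sumr -sumEFin; apply: eq_bigr => eta _.
    by rewrite EFinM EFinD -!TE.
  rewrite -(pair_bigA _ (fun a b => X (a, b)))/= /X/=.
  (* The coordinate and the mask are moved outermost, where [pair_T] applies. *)
  have -> : \sum_eps \sum_eta \sum_Om bern_weight p Om * (c * \sum_k T eps eta k Om) =
     c * \sum_k \sum_Om bern_weight p Om * \sum_eps \sum_eta T eps eta k Om.
    rewrite exchange_big/= mulr_sumr.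
    under [RHS]eq_bigr => k _.
      rewrite mulr_sumr.
      under eq_bigr => Om _.
        rewrite mulrA mulr_sumr.
        under eq_bigr do rewrite mulr_sumr.
        over.
      over.
    under eq_bigr => eta _ do under eq_bigr => eps _ do under eq_bigr => Om _ do
      rewrite mulrA mulr_sumr.
    rewrite exchange_big/=.
    under eq_bigr => eps _ do rewrite exchange_big/=.
    rewrite exchange_big/=.
    under eq_bigr => Om _ do under eq_bigr => eps _ do rewrite exchange_big/=.
    under eq_bigr => Om _ do rewrite exchange_big/=.
    rewrite exchange_big/=.
    by do 4 (apply: eq_bigr => ? _); rewrite [c * _]mulrC.
  rewrite (_ : _ * _ = c * (#|{: {ffun 'I_m -> bool} * H}|%:R / 2 * (m%:R * (1 / 2)))); last by field.
  apply: ler_wpM2l => //.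
  have -> : m%:R * (1 / 2) = \sum_(k < m) (1 / 2 : R) by rewrite sumr_const card_ord mulr_natl.
  rewrite mulr_sumr.
  apply: ler_sum => k _.
  apply: (@le_trans _ _ (#|{: {ffun 'I_m -> bool} * H}|%:R / 2 * \sum_Om bern_weight p Om * kap k Om)).
    by rewrite ler_wpM2l ?hkap// divr_ge0.
  rewrite mulr_sumr; apply: ler_sum => Om _.
  apply: le_trans (_ : bern_weight p Om * (#|{: {ffun 'I_m -> bool} * H}|%:R * (kap k Om / 2)) <= _).
    by rewrite le_eqVlt; apply/orP; left; apply/eqP; field.
  by rewrite ler_wpM2l ?bern_weight_ge0.
Qed.


(** * The hypercube of matrices *)

Section Construction.
Context (R : realType) (r' m n : nat) (m0 : (0 < m)%N) (sstar a q : R) (w : 'I_n -> R).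
Context (sstar0 : 0 < sstar) (q0 : 0 < q) (qa : q <= a) (aq1 : a ^+ 2 + q ^+ 2 = 1).
Context (w1 : \sum_j w j ^+ 2 = 1).
Local Notation signs := {ffun 'I_m -> bool}.
Local Notation colsigns := {ffun 'I_(r' + n) -> bool}.

Definition hyper_u (eps : signs) : 'cV[R]_m.+1 :=
  \col_i (if unlift ord0 i is Some k
          then (if eps k then 1 else -1) * (q / Num.sqrt m%:R) else a).

(** Signs are indexed by the columns of the whole matrix, hence the [rshift], so that the same [eta]
    serves in [sign_rank1]. *)
Definition hyper_v (eta : colsigns) : 'cV[R]_n :=
  \col_j (w j * (-1) ^+ eta (rshift r' j)).

Definition hyper_U (eps : signs) : 'M[R]_(r' + m.+1, r' + 1) :=
  block_mx 1%:M 0 0 (hyper_u eps).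

Definition hyper_V (eta : colsigns) : 'M[R]_(r' + n, r' + 1) :=
  block_mx 1%:M 0 0 (hyper_v eta).

Definition hyper_A (eps : signs) (eta : colsigns) : 'M[R]_(r' + m.+1, r' + n) :=
  hyper_U eps *m diag_mx (const_mx sstar) *m (hyper_V eta)^T.

Lemma sqr_entry : (q / Num.sqrt m%:R) ^+ 2 = q ^+ 2 / m%:R.
Proof. by rewrite expr_div_n sqr_sqrtr// ler0n. Qed.

Lemma sum_cst_div (x : R) : \sum_(k < m) x / m%:R = x.
Proof. by rewrite sumr_const card_ord -[RHS](mulfVK (_ : m%:R != 0)) ?mulr_natr// pnatr_eq0 -lt0n. Qed.

Lemma hyper_u_dot (eps eps' : signs) :
  \sum_i hyper_u eps i 0 * hyper_u eps' i 0 =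
  a ^+ 2 + \sum_k (if eps k == eps' k then 1 else -1) * (q ^+ 2 / m%:R).
Proof.
rewrite big_ord_recl !mxE unlift_none -expr2; congr (_ + _).
apply: eq_bigr => k _; rewrite !mxE liftK -sqr_entry.
by case: (eps k); case: (eps' k) => /=; ring.
Qed.

Lemma hyper_u_norm eps : \sum_i hyper_u eps i 0 ^+ 2 = 1.
Proof.
transitivity (\sum_i hyper_u eps i 0 * hyper_u eps i 0); first by [].
rewrite hyper_u_dot; under eq_bigr do rewrite eqxx mul1r.
by rewrite sum_cst_div.
Qed.

(** The flip turns one summand [q^2 / m] of the squared norm into its opposite. *)
Lemma hyper_u_flip eps k :
  \sum_i hyper_u eps i 0 * hyper_u (flip k eps) i 0 = 1 - 2 * (q ^+ 2 / m%:R).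
Proof.
rewrite hyper_u_dot -[X in _ = X - _]aq1 -[X in _ = _ + X - _]sum_cst_div -!addrA; congr (_ + _).
rewrite (bigD1 k)//= [in RHS](bigD1 k)//= ffunE eqxx.
rewrite (_ : (_ == _) = false); last by case: (eps k).
under eq_bigr => l /negbTE lk do rewrite ffunE lk eqxx mul1r.
ring.
Qed.

Lemma hyper_v_norm eta : \sum_i hyper_v eta i 0 ^+ 2 = 1.
Proof.
rewrite -w1; apply: eq_bigr => j _; rewrite mxE exprMn.
by case: (eta _); rewrite ?expr0 ?expr1 ?sqrrN expr1n mulr1.
Qed.

Lemma block_col_orth d k (v : 'cV[R]_k) : \sum_i v i 0 ^+ 2 = 1 ->
  (block_mx 1%:M 0 0 v : 'M[R]_(d + k, d + 1))^T *m (block_mx 1%:M 0 0 v) = 1%:M.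
Proof.
move=> v1; rewrite tr_block_mx mulmx_block !trmx0 trmx1 !mul0mx !mulmx0 mulmx1.
rewrite !addr0 add0r scalar_mx_block; congr block_mx.
apply/matrixP => i j; rewrite !ord1 !mxE eqxx -v1.
by apply: eq_bigr => l _; rewrite mxE.
Qed.

(** All singular values equal [sstar]. The rank is full because [U^T A V] is the invertible matrix
    [sstar I]. *)
Lemma hyper_A_Mstar eps eta : Mstar_U sstar (hyper_A eps eta) (hyper_U eps).
Proof.
have UU := block_col_orth r' (hyper_u_norm eps).
have VV := block_col_orth r' (hyper_v_norm eta).
have su : diag_mx (const_mx sstar : 'rV[R]_(r' + 1)) \in unitmx.
  by rewrite diag_const_mx -scalemx1 unitmxZ ?unitmx1 ?unitfE ?gt_eqF.
split.
  apply/eqP; rewrite eqn_leq; apply/andP; split.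
    exact: leq_trans (mxrankM_maxr _ _) (leq_trans (rank_leq_row _) _).
  have E : (hyper_U eps)^T *m hyper_A eps eta *m hyper_V eta = diag_mx (const_mx sstar).
    by rewrite /hyper_A !mulmxA UU mul1mx -mulmxA VV mulmx1.
  move: su; rewrite -row_free_unit -row_leq_rank -E => /leq_trans; apply.
  exact: leq_trans (mxrankM_maxl _ _) (mxrankM_maxr _ _).
exists (const_mx sstar), (hyper_V eta); split.
  split => //; [by move=> i; rewrite mxE|by move=> i j _; rewrite !mxE].
exists (rshift r' ord0); split; first by move=> i; rewrite !mxE.
have H (x : R) : 0 < x -> 9 / 10 * x <= x <= 11 / 10 * x by move=> x0; apply/andP; split; lra.
by rewrite mxE; exact: H.
Qed.

Definition ext_u (eps : signs) (i : 'I_(r' + m.+1)) : R := col_mx 0 (hyper_u eps) i 0.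

Definition ext_w (j : 'I_(r' + n)) : R := sstar * (col_mx 0 (\col_j w j) : 'cV[R]_(r' + n)) j 0.

(** Separates the block common to all hypotheses, which a test may add by itself, from the rank-one
    part that carries the signs. *)
Lemma hyper_AE eps eta :
  hyper_A eps eta = block_mx sstar%:M 0 0 0 + sign_rank1 (ext_u eps) ext_w eta.
Proof.
have -> : hyper_A eps eta = sstar *: (hyper_U eps *m (hyper_V eta)^T).
  by rewrite /hyper_A diag_const_mx mul_mx_scalar -scalemxAl.
rewrite tr_block_mx mulmx_block !trmx0 trmx1 !mul0mx !mulmx0 mulmx1.
rewrite !addr0 add0r scale_block_mx !scaler0.
apply/matrixP => i j; rewrite [in RHS]mxE [X in _ + X]mxE /ext_u /ext_w.
case: (split_ordP i) => i' ->; case: (split_ordP j) => j' ->;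
  rewrite ?block_mxEul ?block_mxEur ?block_mxEdl ?block_mxEdr ?col_mxEu ?col_mxEd !mxE.
- by rewrite !mul0r addr0 mulr_natr.
- by rewrite !mul0r addr0.
- by rewrite !(mulr0, mul0r) addr0.
- by rewrite big_ord1 !mxE add0r; ring.
Qed.

Lemma ext_sum (k d : nat) (f : R -> R) (v : 'cV[R]_k) : f 0 = 0 ->
  \sum_i f ((col_mx 0 v : 'cV[R]_(d + k)) i 0) = \sum_i f (v i 0).
Proof.
move=> f0; rewrite big_split_ord/= big1 ?add0r.
  by apply: eq_bigr => i _; rewrite col_mxEd.
by move=> i _; rewrite col_mxEu mxE.
Qed.

Lemma ext_u_norm eps : \sum_i ext_u eps i ^+ 2 = 1.
Proof. by rewrite (ext_sum _ (f := fun x => x ^+ 2)) ?hyper_u_norm// expr0n. Qed.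

Lemma ext_w_norm : \sum_j ext_w j ^+ 2 = sstar ^+ 2.
Proof.
rewrite (ext_sum _ (f := fun x => (sstar * x) ^+ 2)); last by rewrite mulr0 expr0n.
rewrite -[RHS]mulr1 -w1 mulr_sumr.
by apply: eq_bigr => j _; rewrite mxE exprMn.
Qed.

Lemma ext_u_flip eps k :
  \sum_i ext_u eps i * ext_u (flip k eps) i = 1 - 2 * (q ^+ 2 / m%:R).
Proof.
rewrite big_split_ord/= big1 ?add0r => [|i _]; last by rewrite /ext_u col_mxEu mxE mul0r.
by rewrite -(hyper_u_flip eps k); apply: eq_bigr => i _; rewrite /ext_u !col_mxEd.
Qed.

Definition sign_dec (k : 'I_m) (Uh : 'M[R]_(r' + m.+1, r' + 1)) : bool :=
  0 < \sum_b Uh (rshift r' (lift ord0 k)) b * Uh (rshift r' ord0) b.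

Local Notation mask := {ffun 'I_(r' + m.+1) * 'I_(r' + n) -> bool}.
Local Notation obs := (((r' + m.+1) * (r' + n)).-tuple R).

Definition hyper_shift eps eta : 'I_((r' + m.+1) * (r' + n)) -> R :=
  mxvec (sign_rank1 (ext_u eps) ext_w eta) 0.

(* Tests see only the entries in [Om]; the column signs [eta] are averaged out on
   both sides, so that this bounds a test between two mixtures. *)
Definition flip_testable (sigma : R) (kap : 'I_m -> mask -> R) : Prop :=
  forall eps k Om (psi : obs -> bool), measurable_fun setT psi ->
    (forall t t', P_Omega Om (tuple_mx t) = P_Omega Om (tuple_mx t') -> psi t = psi t') ->
    ((kap k Om)%:E <= \sum_(eta : colsigns) (#|{: colsigns}|%:R^-1)%:E *
      (gauss_expect sigma (fun t => (psi (tshift (hyper_shift eps eta) t))%:R%:E) +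
       gauss_expect sigma (fun t => (~~ psi (tshift (hyper_shift (flip k eps) eta) t))%:R%:E)))%E.

Lemma hyper_risk_lower_bound (sigma p C : R) (nrm : 'M[R]_(r' + m.+1, r' + 1) -> R)
    (Uhat : mask -> 'M[R]_(r' + m.+1, r' + n) -> 'M[R]_(r' + m.+1, r' + 1))
    (kap : 'I_m -> mask -> R) :
  0 <= p <= 1 -> 0 < C -> (forall M, 0 <= nrm M) ->
  (forall M x, vnorm2 (M *m x) <= C * nrm M * vnorm2 x) ->
  estimator_measurable Uhat ->
  flip_testable sigma kap -> (forall k, 1 / 2 <= \sum_Om bern_weight p Om * kap k Om) ->
  ((q / (12 * C))%:E <= worst_risk sigma p sstar nrm Uhat)%E.
Proof.
move=> p01 C0 nrm0 Hn mU test hkap.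
have mR : 0 < m%:R :> R by rewrite ltr0n.
have -> : q / (12 * C) = q / (3 * C * m%:R) * m%:R / 4 by field; rewrite !gt_eqF.
have mdec Om B k : measurable_fun setT
    (fun t => sign_dec k (Uhat Om (P_Omega Om (B + tuple_mx t)))).
  apply: measurable_fun_ltr => //; apply: measurable_sum => b.
  by apply: measurable_funM; exact: measurable_estimator_obs.
apply: (@assouad _ _ _ _ m colsigns sigma p sstar nrm Uhat hyper_A hyper_U sign_dec _ kap) => //.
- by rewrite divr_ge0 ?mulr_ge0 ?ltW.
- by apply/card_gt0P; exists [ffun=> true].
- exact: hyper_A_Mstar.
- move=> eps Uh; apply: le_rot_loss => Q oQ.
  apply: (@wrong_sign_loss _ _ _ m nrm C (hyper_U eps) Uh Q (rshift r' ord0) (rshift r' ord0)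
    (fun k => rshift r' (lift ord0 k)) eps a q) => //.
  + by move=> k k' /rshift_inj/lift_inj.
  + move=> j; case: (split_ordP j) => j' ->.
      by rewrite block_mxEdl mxE eq_lrshift mulr0.
    by rewrite block_mxEdr mxE unlift_none !ord1 eqxx mulr1.
  + move=> k j; case: (split_ordP j) => j' ->.
      by rewrite block_mxEdl mxE eq_lrshift mulr0.
    by rewrite block_mxEdr mxE liftK !ord1 eqxx mulr1.
- move=> eps k Om.
  pose A0 : 'M[R]_(r' + m.+1, r' + n) := block_mx sstar%:M 0 0 0.
  (* The common block is absorbed into the test, so that the hypotheses differ from pure noise only
     by [hyper_shift]. *)
  pose psi (t : obs) := sign_dec k (Uhat Om (P_Omega Om (A0 + tuple_mx t))) != eps k.
  have mpsi : measurable_fun setT psi.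
    rewrite /psi; case: (eps k).
      rewrite (_ : (fun t => _) = fun t => ~~ sign_dec k (Uhat Om (P_Omega Om (A0 + tuple_mx t)))); last first.
        by apply/funext => t; case: sign_dec.
      apply: measurable_neg; exact: mdec.
    rewrite (_ : (fun t => _) = fun t => sign_dec k (Uhat Om (P_Omega Om (A0 + tuple_mx t)))); last first.
      by apply/funext => t; case: sign_dec.
    exact: mdec.
  have ipsi t t' : P_Omega Om (tuple_mx t) = P_Omega Om (tuple_mx t') -> psi t = psi t'.
    move=> tt'; rewrite /psi.
    suff -> : P_Omega Om (A0 + tuple_mx t) = P_Omega Om (A0 + tuple_mx t') by [].
    apply/matrixP => i j; have := congr1 (fun M : 'M[R]_(_, _) => M i j) tt'.
    by rewrite !mxE; case: (Om _) => // ->.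
  apply: le_trans (test eps k Om psi mpsi ipsi) _.
  rewrite le_eqVlt; apply/orP; left; apply/eqP; apply: eq_bigr => eta _.
  congr (_ * (_ + _))%E; apply: eq_gauss_expect => t; rewrite /psi.
    by rewrite -addmx_tuple_mx addrA -hyper_AE.
  by rewrite -addmx_tuple_mx addrA -hyper_AE ffunE eqxx; case: sign_dec; case: (eps k).
Qed.

Lemma average_ge (H : finType) (x : H -> \bar R) (y : R) : (0 < #|H|)%N ->
  (forall h, (y%:E <= x h)%E) -> (y%:E <= \sum_h (#|H|%:R^-1)%:E * x h)%E.
Proof.
move=> H0 yx; apply: (@le_trans _ _ (\sum_(h : H) (#|H|%:R^-1 * y)%:E)%E).
  rewrite sumEFin sumr_const -mulrnAl lee_fin -mulr_natr mulVf ?mul1r//.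
  by rewrite pnatr_eq0 -lt0n.
by apply: lee_sum => h _; rewrite EFinM lee_wpmul2l// lee_fin invr_ge0.
Qed.

Let colsigns_gt0 : (0 < #|{: colsigns}|)%N.
Proof. by apply/card_gt0P; exists [ffun=> true]. Qed.

(** The flip changes only the entry of row [k] and column [j0]. If it is hidden, the test behaves
    identically under both hypotheses and its two errors add up to 1. *)
Lemma flip_testable_unobserved (sigma : R) (j0 : 'I_n) :
  (forall j, j != j0 -> w j = 0) ->
  flip_testable sigma (fun k Om => (~~ Om (rshift r' (lift ord0 k), rshift r' j0))%:R).
Proof.
move=> wj eps k Om psi mpsi ipsi; apply: average_ge => // eta.
have E0 (f : obs -> bool) : (0 <= gauss_expect sigma (fun t => (f t)%:R%:E))%E.
  by apply: gauss_expect_ge0 => t; rewrite lee_fin ler0n.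
have [_|unobs] := boolP (Om _); first by rewrite adde_ge0.
have same t : psi (tshift (hyper_shift (flip k eps) eta) t) = psi (tshift (hyper_shift eps eta) t).
  apply: ipsi; rewrite -!addmx_tuple_mx.
  apply/matrixP => i j; rewrite !mxE; case: ifP => // Omij; congr (_ + _).
  rewrite /ext_u /ext_w; case: (split_ordP i) Omij => i' ->; case: (split_ordP j) => j' -> Omij;
    rewrite ?col_mxEu ?col_mxEd !mxE ?(mulr0, mul0r)//.
  have [j'j0|/wj ->] := eqVneq j' j0; last by rewrite mulr0 mul0r !mulr0.
  case: (unliftP ord0 i') Omij => [l|] -> Omij //; rewrite ffunE.
  by case: eqP Omij unobs => // -> ; rewrite j'j0 => ->.
under [X in (_ + X)%E]eq_gauss_expect do rewrite same.
have mI (f : obs -> bool) := @measurable_EFin_nat_of_bool _ _ R f.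
have mps : measurable_fun setT (fun t => psi (tshift (hyper_shift eps eta) t)).
  by apply: (measurableT_comp mpsi); exact: measurable_tshift.
rewrite -ge0_gauss_expectD; last 4 first.
- exact: (mI (fun t => psi (tshift (hyper_shift eps eta) t))).
- by move=> t; rewrite lee_fin ler0n.
- apply: (mI (fun t => ~~ psi (tshift (hyper_shift eps eta) t))).
  apply: measurable_neg; exact: mps.
- by move=> t; rewrite lee_fin ler0n.
rewrite -[leLHS](gauss_expect_cst sigma ((r' + m.+1) * (r' + n))).
apply: le_gauss_expect => t; rewrite lee_fin ?ler0n//.
by case: (psi _); rewrite ?addr0 ?add0r.
Qed.

(** For each fixed [eta] the two shifts are at squared distance [4 (q^2 / m) sstar^2]. *)
Lemma flip_testable_two_point (sigma : R) : sigma != 0 ->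
  4 * (q ^+ 2 / m%:R) * (sstar ^+ 2 / sigma ^+ 2) <= 1 / 2 ->
  flip_testable sigma (fun _ _ => 1 / 2).
Proof.
move=> s0 small eps k Om psi mpsi ipsi; apply: average_ge => // eta.
apply: two_point_test => //; apply: le_trans small.
rewrite mulrA ler_pM2r ?invr_gt0 ?exprn_even_gt0//.
rewrite sum_mxvec_index.
under eq_bigr => i _ do under eq_bigr => j _ do rewrite /hyper_shift !mxvecE !mxE -mulrBl exprMn.
have -> : 4 * (q ^+ 2 / m%:R) = \sum_i (ext_u eps i - ext_u (flip k eps) i) ^+ 2.
  transitivity (\sum_i ((ext_u eps i ^+ 2 + ext_u (flip k eps) i ^+ 2) -
     2 * (ext_u eps i * ext_u (flip k eps) i))).
    rewrite sumrB big_split/= -mulr_sumr !ext_u_norm ext_u_flip; ring.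
  by apply: eq_bigr => i _; ring.
rewrite -ext_w_norm mulr_suml; apply: ler_sum => i _.
rewrite mulr_sumr; apply: ler_sum => j _.
by case: (eta j); rewrite ?expr1 ?expr0 ?mulrN1 ?mulr1 ?sqrrN.
Qed.

(** Here [1 - rho = 2 q^2 / m], and each of the [n] signal columns has [z = sstar^2 / (sigma^2 n)].
    Summing gives the constant 32; [q <= a] ensures [rho >= 0]. *)
Lemma flip_testable_mixture (sigma : R) : sigma != 0 ->
  (forall j, w j ^+ 2 = n%:R^-1) -> sstar ^+ 2 / sigma ^+ 2 <= n%:R ->
  32 * (q ^+ 2 / m%:R) * ((sstar ^+ 2 / sigma ^+ 2) ^+ 2 / n%:R) <= 1 / 2 ->
  flip_testable sigma (fun _ _ => 1 / 2).
Proof.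
move=> s0 wn z1 small eps k Om psi mpsi ipsi.
have mR : 1 <= m%:R :> R by rewrite ler1n.
have qm0 : 0 <= q ^+ 2 / m%:R by rewrite divr_ge0 ?sqr_ge0.
have qm1 : q ^+ 2 / m%:R <= 1 / 2.
  rewrite ler_pdivrMr ?(lt_le_trans _ mR)//.
  have q2 : q ^+ 2 <= a ^+ 2 by rewrite ler_pXn2r ?nnegrE ?(ltW q0)// (le_trans (ltW q0)).
  have H (x y M : R) : y + x = 1 -> x <= y -> 1 <= M -> x <= 1 / 2 * M by lra.
  exact: H aq1 q2 mR.
have rho01 (x : R) : 0 <= x -> x <= 1 / 2 -> 0 <= 1 - 2 * x <= 1.
  by move=> x0 x1; apply/andP; split; lra.
apply: (@sign_mixture_test _ _ s0 _ _ _ _ _ (1 - 2 * (q ^+ 2 / m%:R))) => //.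
- exact: ext_u_norm.
- exact: ext_u_norm.
- exact: ext_u_flip.
- exact: rho01.
- move=> j; rewrite /ext_w; case: (split_ordP j) => j' ->.
    by rewrite col_mxEu mxE mulr0 expr0n mul0r.
  rewrite col_mxEd mxE exprMn wn.
  have n0 : 0 < n%:R :> R by rewrite ltr0n; case: (j') => ? /(leq_trans _); apply.
  by rewrite mulrAC ler_pdivrMr// mul1r.
- apply: le_trans small.
  rewrite /ext_w (ext_sum _ (f := fun x => 16 * (((sstar * x) ^+ 2 / sigma ^+ 2) ^+ 2 *
     (1 - (1 - 2 * (q ^+ 2 / m%:R)))))); last by rewrite !(mulr0, expr0n, mul0r).
  under eq_bigr => j _ do rewrite mxE [(sstar * _) ^+ 2]exprMn wn.
  rewrite sumr_const card_ord -mulr_natr.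
  have [n0|n0] := posnP n.
    by rewrite n0 mulr0n invr0 !mulr0.
  have nR : n%:R != 0 :> R by rewrite pnatr_eq0 -lt0n.
  rewrite le_eqVlt; apply/orP; left; apply/eqP.
  have mR0 : m%:R != 0 :> R by rewrite pnatr_eq0 -lt0n.
  by field; rewrite nR mR0 s0.
Qed.

End Construction.


(** * Choice of the radius *)

Lemma sum_sqr_delta (R : realType) n (j0 : 'I_n) : \sum_(j < n) ((j == j0)%:R : R) ^+ 2 = 1.
Proof.
rewrite (bigD1 j0)//= eqxx expr1n big1 ?addr0// => j /negbTE ->.
by rewrite expr0n.
Qed.

Lemma sqrt_1Bsqr (R : realType) (q : R) : 0 < q -> q <= 1 / 2 ->
  q <= Num.sqrt (1 - q ^+ 2) /\ Num.sqrt (1 - q ^+ 2) ^+ 2 + q ^+ 2 = 1.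
Proof.
move=> q0 q1; have h : 0 <= 1 - q ^+ 2 by nra.
split; last by rewrite sqr_sqrtr// subrK.
by rewrite -(@ler_pXn2r _ 2) ?nnegrE ?sqrtr_ge0 ?(ltW q0)// sqr_sqrtr//; nra.
Qed.

Lemma min_rate_le (R : realFieldType) (X Y K : R) : 1 <= K -> 0 <= Y -> X <= K * Y ->
  Num.min X 1 <= K * Num.min Y 1.
Proof.
by move=> K1 Y0 XY; rewrite minEle minEle; case: ifP; case: ifP => /negP/negP; rewrite -?ltNge; nra.
Qed.

(* The first alternative is the regime of the two-point test, the second that of
   the mixture test. *)
Lemma signal_radius (R : realType) (p x M N D1 D2 : R) :
  1 / 2 < p -> 0 < x -> 0 < D1 -> 0 < D2 -> 0 < M -> 0 < N ->
  D1 ^+ 2 <= 2 * M -> (D1 < D2 -> D2 ^+ 2 <= 2 * N) ->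
  exists q, [/\ 0 < q, q <= 1 / 2,
    Num.min (x ^+ 2 * (D1 * D2 / p) + x * (D1 * Num.sqrt p^-1)) 1 <= 80 * q &
    8 * q ^+ 2 <= x ^+ 2 * M \/ 1 <= x ^+ 2 * N /\ 64 * q ^+ 2 <= x ^+ 4 * (M * N)].
Proof.
move=> p12 x0 D10 D20 M0 N0 D1M D2N.
have pV : p^-1 <= 2 by rewrite -[leLHS]mul1r ler_pdivrMr; lra.
pose Y := x * D1; pose Z := x ^+ 2 * (D1 * D2).
have Y0 : 0 < Y by rewrite mulr_gt0.
have xD0 : 0 < x * D2 by rewrite mulr_gt0.
have x20 : 0 < x ^+ 2 by rewrite exprn_gt0.
have Z0 : 0 < Z by apply: mulr_gt0 => //; exact: mulr_gt0.
have ZY : Z = Y * (x * D2) by rewrite /Z /Y; ring.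
set X := x ^+ 2 * _ + _.
have XZY : X <= 2 * Z + 2 * Y.
  have s2 : Num.sqrt p^-1 <= 2.
    rewrite -(@ler_pXn2r _ 2) ?nnegrE ?sqrtr_ge0// sqr_sqrtr ?invr_ge0; lra.
  apply: lerD.
    have -> : x ^+ 2 * (D1 * D2 / p) = p^-1 * Z by rewrite /Z; ring.
    by rewrite ler_wpM2r// ltW.
  have -> : x * (D1 * Num.sqrt p^-1) = Num.sqrt p^-1 * Y by rewrite /Y; ring.
  by rewrite ler_wpM2r// ltW.
have min_gt0 V : 0 < V -> 0 < Num.min V 1 :> R by move=> V0; rewrite lt_min V0 ltr01.
have min_le V : Num.min V 1 <= V :> R by rewrite ge_min lexx.
have min_le1 V : Num.min V 1 <= 1 :> R by rewrite ge_min lexx orbT.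
(* If the linear term [Y] controls the rate, [q = min (Y, 1) / 4] fits the two-point test. *)
have small : Num.min X 1 <= 6 * Num.min Y 1 -> exists q, [/\ 0 < q, q <= 1 / 2,
    Num.min X 1 <= 80 * q &
    8 * q ^+ 2 <= x ^+ 2 * M \/ 1 <= x ^+ 2 * N /\ 64 * q ^+ 2 <= x ^+ 4 * (M * N)].
  move=> h; have m0 := min_gt0 _ Y0; have mY := min_le Y; have m1 := min_le1 Y.
  move: (Num.min Y 1) h m0 mY m1 => mu h m0 mY m1.
  exists (mu / 4); split; [lra|lra|lra|left].
  have mm : mu ^+ 2 <= Y ^+ 2 by rewrite ler_pXn2r ?nnegrE ?(ltW m0) ?(ltW Y0).
  have YM : Y ^+ 2 <= x ^+ 2 * (2 * M) by rewrite /Y exprMn ler_pM2l.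
  rewrite exprMn; lra.
(* In this case [Z <= 2 * Y], so [X <= 6 * Y]. *)
have [xD|xD] := leP (x * D2) 2.
  apply: small; apply: min_rate_le; [lra|exact: ltW|].
  by apply: le_trans XZY _; rewrite ZY; nra.
(* Now [x * D2 > 2]; if [D2 <= D1] then [Y >= 1] and the truncated rate is at most 1. Otherwise the
   quadratic term dominates. *)
have [d21|d12] := leP D2 D1.
  apply: small; have Y1 : 1 <= Y.
    have : x * D2 <= x * D1 by rewrite ler_pM2l.
    by rewrite -/Y; lra.
  by have := min_le1 X; rewrite (min_r Y1); lra.
have YZ : Y <= Z by rewrite ZY ler_peMr ?(ltW Y0)//; lra.
have D2N' := D2N d12.
have xx : x ^+ 2 * D2 ^+ 2 <= x ^+ 2 * (2 * N) by rewrite ler_pM2l.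
have x4 : 4 <= x ^+ 2 * D2 ^+ 2.
  by rewrite -exprMn; nra.
have h : Num.min X 1 <= 4 * Num.min Z 1.
  by apply: min_rate_le; [lra|exact: ltW|apply: le_trans XZY _; lra].
have m0 := min_gt0 _ Z0; have mZ := min_le Z; have m1 := min_le1 Z.
move: (Num.min Z 1) h m0 mZ m1 => mu h m0 mZ m1.
(* With [q = mu / 16], [64 * q^2 = mu^2 / 4 <= Z^2 / 4], and the 4 pays for replacing [D1^2] and
   [D2^2] by [2 * M] and [2 * N]. *)
exists (mu / 16); split; [lra|lra|lra|right]; split; first by lra.
have mm : mu ^+ 2 <= Z ^+ 2 by rewrite ler_pXn2r ?nnegrE ?(ltW m0) ?(ltW Z0).
have ZMN : Z ^+ 2 <= x ^+ 4 * ((2 * M) * (2 * N)).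
  rewrite (_ : Z ^+ 2 = x ^+ 4 * (D1 ^+ 2 * D2 ^+ 2)); last by rewrite /Z; ring.
  by rewrite ler_pM2l ?exprn_gt0// ler_pM ?sqr_ge0.
rewrite exprMn; lra.
Qed.

(** * Assembly of the lower bounds *)

Lemma minimax_bound (R : realType) (r' m n : nat) (sigma p sstar C : R)
    (nrm : 'M[R]_(r' + m.+1, r' + 1) -> R)
    (Uhat : {ffun 'I_(r' + m.+1) * 'I_(r' + n) -> bool} ->
            'M[R]_(r' + m.+1, r' + n) -> 'M[R]_(r' + m.+1, r' + 1)) :
  (r' < m)%N -> (0 < n)%N -> 0 < sigma -> 0 < p -> p <= 1 -> 0 < sstar ->
  0 < C -> (forall M, 0 <= nrm M) ->
  (forall M x, vnorm2 (M *m x) <= C * nrm M * vnorm2 x) ->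
  estimator_measurable Uhat ->
  let d1 := (r' + m.+1)%N in let d2 := (r' + n)%N in
  let rate := Num.min (sigma ^+ 2 / sstar ^+ 2 * (Num.sqrt (d1%:R * d2%:R) / p)
                       + sigma / sstar * Num.sqrt (d1%:R / p)) 1 in
  ((1 / 1000 / C * rate)%:E <= worst_risk sigma p sstar nrm Uhat)%E : Prop.
Proof.
move=> rm n0 s0 p0 p1 ss0 C0 nrm0 Hn mU d1 d2 rate.
have m0 : (0 < m)%N by exact: leq_ltn_trans rm.
have p01 : 0 <= p <= 1 by rewrite (ltW p0).
pose j0 := Ordinal n0.
pose wd (j : 'I_n) : R := (j == j0)%:R.
have wd1 : \sum_j wd j ^+ 2 = 1 by exact: sum_sqr_delta.
have rate1 : rate <= 1 by rewrite /rate ge_min lexx orbT.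
have rate0 : 0 <= rate.
  by rewrite le_min ler01 andbT addr_ge0// mulr_ge0 ?divr_ge0 ?sqrtr_ge0 ?sqr_ge0 ?ltW.
have bound (q : R) (w : 'I_n -> R)
    (kap : 'I_m -> {ffun 'I_(r' + m.+1) * 'I_(r' + n) -> bool} -> R) :
    0 < q -> q <= 1 / 2 -> rate <= 80 * q ->
    \sum_j w j ^+ 2 = 1 ->
    flip_testable sstar (Num.sqrt (1 - q ^+ 2)) q w sigma kap ->
    (forall k, 1 / 2 <= \sum_Om bern_weight p Om * kap k Om) ->
    ((1 / 1000 / C * rate)%:E <= worst_risk sigma p sstar nrm Uhat)%E.
  move=> q0 q1 rq w1 T hk; have [qa aq1] := sqrt_1Bsqr q0 q1.
  apply: le_trans (hyper_risk_lower_bound m0 ss0 q0 qa aq1 w1 p01 C0 nrm0 Hn mU T hk).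
  (* The constant 1/1000 is small enough because [80 * 12 / 1000 < 1]. *)
  rewrite lee_fin (_ : 1 / 1000 / C * rate = (12 / 1000 * rate) / (12 * C)); last first.
    by field; rewrite gt_eqF.
  rewrite ler_pM2r ?invr_gt0 ?mulr_gt0//; move: rq rate0; clear; lra.
(* For [p <= 1 / 2] the constant radius [q = 1 / 2] works, as each entry is hidden with probability
   at least 1/2. *)
have [p12|p12] := leP p (1 / 2).
  have h0 : 0 < 1 / 2 :> R by rewrite divr_gt0.
  apply: (bound (1 / 2) wd _ h0 (lexx _) _ wd1
    (flip_testable_unobserved _ _ _ _ (j0 := j0) _)).
  - by move: rate1; clear; lra.
  - by move=> j /negbTE; rewrite /wd => ->.
  - by move=> k; rewrite sum_bern_weight_unobserved; move: p12; clear; lra.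
pose kh (_ : 'I_m) (_ : {ffun 'I_(r' + m.+1) * 'I_(r' + n) -> bool}) : R := 1 / 2.
have half k : 1 / 2 <= \sum_Om bern_weight p Om * kh k Om.
  by rewrite /kh -mulr_suml sum_bern_weight !mul1r.
have sn0 : sigma != 0 by rewrite gt_eqF.
have mR : 0 < m%:R :> R by rewrite ltr0n.
have nR : 0 < n%:R :> R by rewrite ltr0n.
pose x := sigma / sstar.
have x0 : 0 < x by rewrite divr_gt0.
have D1s : Num.sqrt d1%:R ^+ 2 = d1%:R :> R by rewrite sqr_sqrtr ?ler0n.
have D2s : Num.sqrt d2%:R ^+ 2 = d2%:R :> R by rewrite sqr_sqrtr ?ler0n.
have [q [q0 q1 rq regime]] : exists q, [/\ 0 < q, q <= 1 / 2, rate <= 80 * q &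
    8 * q ^+ 2 <= x ^+ 2 * m%:R \/
    1 <= x ^+ 2 * n%:R /\ 64 * q ^+ 2 <= x ^+ 4 * (m%:R * n%:R)].
  rewrite /rate -expr_div_n sqrtrM ?ler0n// [Num.sqrt (d1%:R / p)]sqrtrM ?ler0n//.
  apply: signal_radius => //.
  - by rewrite sqrtr_gt0 ltr0n /d1 addnS.
  - by rewrite sqrtr_gt0 ltr0n /d2 addn_gt0 n0 orbT.
  - by rewrite D1s -natrM ler_nat /d1 mul2n -addnn addnS -addSn leq_add2r.
  (* [d1 < d2] means [m + 1 < n]; with [r' < m] this makes [n] comparable to [d2]. *)
  - rewrite ltr_sqrt ?ltr0n ?addn_gt0 ?n0 ?orbT// ltr_nat ltn_add2l => mn.
    rewrite D2s -natrM ler_nat /d2 mul2n -addnn leq_add2r.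
    by apply: ltnW; apply: ltn_trans rm _; exact: ltnW.
have [qa aq1] := sqrt_1Bsqr q0 q1.
have xs : sstar ^+ 2 / sigma ^+ 2 = (x ^+ 2)^-1.
  by rewrite /x expr_div_n invf_div.
have x2 : 0 < x ^+ 2 by rewrite exprn_gt0.
case: regime => [small|[xn small]].
  apply: (bound q wd kh q0 q1 rq wd1 (flip_testable_two_point m0 aq1 wd1 sn0 _) half).
  rewrite xs -[leLHS]/(_ / _) ler_pdivrMr// mulrA ler_pdivrMr//.
  by move: small; clear; lra.
have wn2 : (Num.sqrt n%:R)^-1 ^+ 2 = n%:R^-1 :> R by rewrite exprVn sqr_sqrtr ?ler0n.
have wn1 : \sum_(j < n) (Num.sqrt n%:R)^-1 ^+ 2 = 1 :> R.
  by rewrite wn2 sumr_const card_ord -(mulr_natr n%:R^-1) mulVf// gt_eqF.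
apply: (bound q (fun=> (Num.sqrt n%:R)^-1) kh q0 q1 rq wn1 _ half).
apply: (flip_testable_mixture m0 q0 qa aq1) => //.
  by rewrite xs -[leLHS]mul1r ler_pdivrMr// mulrC.
have -> : 32 * (q ^+ 2 / m%:R) * ((sstar ^+ 2 / sigma ^+ 2) ^+ 2 / n%:R) =
    32 * q ^+ 2 / (x ^+ 4 * (m%:R * n%:R)).
  by rewrite xs; field; rewrite !gt_eqF.
have xmn : 0 < x ^+ 4 * (m%:R * n%:R) by apply: mulr_gt0; [exact: exprn_gt0|exact: mulr_gt0].
rewrite ler_pdivrMr//; move: small; clear; lra.
Qed.

Lemma spec_norm_ge0 (R : realType) m n (M : 'M[R]_(m, n.+1)) : 0 <= spec_norm M.
Proof.
pose x : 'cV[R]_n.+1 := delta_mx 0 0.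
have x1 : vnorm2 x = 1.
  rewrite /vnorm2 -[RHS]sqrtr1; congr Num.sqrt.
  rewrite -[RHS](sum_sqr_delta R (ord0 : 'I_n.+1)).
  by apply: eq_bigr => i _; rewrite mxE eqxx andbT.
have := vnorm2_mulmx_le_spec M x; rewrite x1 mulr1.
by apply: le_trans; exact: vnorm2_ge0.
Qed.

Lemma two_inf_norm_ge0 (R : realType) m n (M : 'M[R]_(m, n)) : 0 <= two_inf_norm M.
Proof. exact: bigmax_ge_id. Qed.

Theorem theorem2 (R : realType) :
  exists c_lb : R, 0 < c_lb /\
  forall (d1 d2 r : nat), (1 <= r)%N -> (r.*2 <= d1)%N -> (r <= d2)%N ->
  forall (sigma p sstar : R), 0 < sigma -> 0 < p -> p <= 1 -> 0 < sstar ->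
  let rate := Num.min (sigma ^+ 2 / sstar ^+ 2 * (Num.sqrt (d1%:R * d2%:R) / p)
                       + sigma / sstar * Num.sqrt (d1%:R / p)) 1 in
  forall Uhat : {ffun 'I_d1 * 'I_d2 -> bool} -> 'M[R]_(d1, d2) -> 'M[R]_(d1, r),
    estimator_measurable Uhat ->
    ((c_lb * rate)%:E <= worst_risk sigma p sstar (@spec_norm R d1 r) Uhat)%E /\
    ((c_lb / Num.sqrt d1%:R * rate)%:E
       <= worst_risk sigma p sstar (@two_inf_norm R d1 r) Uhat)%E.
Proof.
exists (1 / 1000); split; first by lra.
move=> d1 d2 [//|r'] _ rd1 rd2; rewrite -addn1 in rd1 rd2 *.
(* Here [m = d1 - r], and [r' < m] is the assumption that [r] is at most [d1 / 2]. *)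
have [m [rm d1E]] : exists m, (r' < m)%N /\ d1 = (r' + m.+1)%N.
  by exists (d1 - (r' + 1))%N; split; lia.
have [n [n0 d2E]] : exists n, (0 < n)%N /\ d2 = (r' + n)%N.
  by exists (d2 - r')%N; split; lia.
subst d1 d2 => {rd1 rd2} sigma p sstar s0 p0 p1 ss0 rate Uhat mU.
split.
  (* The comparison constant [C] is 1 for the spectral norm and [sqrt d1] for the other norm. *)
  rewrite -[1 / 1000]divr1; apply: minimax_bound => //.
  - by move: (r' + 1)%N (addn1 r') => _ -> M; exact: spec_norm_ge0.
  - by move=> M x; rewrite mul1r; exact: vnorm2_mulmx_le_spec.
apply: minimax_bound => //.
- exact: two_inf_norm_ge0.
- exact: vnorm2_mulmx_le_two_inf.
Qed.
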